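(* Let $X$ be a random vector in $\mathbb R^d$ with density $f_X$ and compact support $S_X\subset\mathbb R^d$ such that: (X2) there are $c>0$ and $T>0$ with $\lambda(S_X\cap B(x,\tau))\ge c\,\lambda(B(x,\tau))$ for all $\tau\in(0,T]$ and $x\in S_X$, where $\lambda$ is Lebesgue measure; (X3) there are $0<b_X\le U_X<\infty$ with $b_X\le f_X(x)\le U_X$ for all $x\in S_X$. For each $n$ let $p=p_n\in(0,1)$, $k=k_n\in\{1,\dots,n\}$, and suppose that the regression function $\eta=\eta_n$ is such that $x\mapsto\eta(x)/p$ is $L$-Lipschitz on $S_X$, with $L$ not depending on $n$. Then, whenever $p\to0$, $kp/\log(n)\to\infty$ and $k/n\to0$ as $n\to\infty$, the balanced $k$-NN classifier $\hat g$ satisfies, with probability $1$, $$\mathcal R_p(\hat g)-\mathcal R_p(g_p^* )\;\longrightarrow\;0 .$$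
   Context: For each $n$, the data $(X_i,Y_i)_{1\le i\le n}$ (for all $n$ defined on a common probability space) are i.i.d. copies of a pair $(X,Y)$ with $Y\in\{-1,1\}$, $p=p_n=\mathbb P(Y=1)$ and $\eta(x)=\eta_n(x)=\mathbb P(Y=1\mid X=x)$; the distribution of $X$ (hence $f_X,S_X,c,T,b_X,U_X$) does not depend on $n$. $\hat p=\frac1n\sum_{i=1}^n\mathbf 1\{Y_i=1\}$. $B(x,\tau)$ is the closed Euclidean ball of center $x$ and radius $\tau$. The $k$-NN radius at $x$ is $\hat\tau_x=\inf\{\tau\ge0:\sum_{i=1}^n\mathbf 1_{B(x,\tau)}(X_i)\ge k\}$, $\hat I(x)=\{i:X_i\in B(x,\hat\tau_x)\}$, and $\hat\eta(x)=\frac1k\sum_{i\in\hat I(x)}\mathbf 1\{Y_i=1\}$. The balanced $k$-NN classifier $\hat g$ predicts $\hat g(x)=1$ if $\hat\eta(x)\ge\hat p$ and $\hat g(x)=-1$ otherwise. For a classifier $g:\mathbb R^d\to\{-1,1\}$ (possibly depending on the sample), the balanced (AM) risk is $\mathcal R_p(g)=\frac12\big(\mathbb P(g(X)\ne Y\mid Y=1)+\mathbb P(g(X)\neq Y\mid Y=-1)\big)$, where $(X,Y)$ is independent of the sample and $g$ is held fixed. $g_p^*$ is the balanced Bayes classifier: $g_p^*(x)=1$ if $\eta(x)\ge p$ and $-1$ otherwise. *)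

(* Defs.v *)
From HB Require Import structures.
From mathcomp Require Import all_boot all_order all_algebra.
From mathcomp Require Import all_classical all_reals all_analysis.

Set Implicit Arguments.
Unset Strict Implicit.
Unset Printing Implicit Defensive.
Import Order.TTheory GRing.Theory Num.Theory.
Import numFieldNormedType.Exports.

Local Open Scope classical_set_scope.
Local Open Scope ring_scope.

(* R^d as d-tuples, whose library sigma-algebra is the one generated by the
   coordinate projections, i.e. the Borel sigma-algebra. *)
Notation Rd R d := (d.-tuple (measurableTypeR R))%type.

Section lebesgue_Rd.
Context {R : realType}.
Local Open Scope ereal_scope.

Lemma sigma_finite_product d1 d2 (T1 : measurableType d1)
    (T2 : measurableType d2) (m1 : {sigma_finite_measure set T1 -> \bar R})
    (m2 : {sigma_finite_measure set T2 -> \bar R}) :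
  sigma_finite setT (m1 \x m2).
Proof.
have /sigma_finiteP[F [TF ndF Foo]] := sigma_finiteT m1.
have /sigma_finiteP[G [TG ndG Goo]] := sigma_finiteT m2.
exists (fun n => F n `*` G n).
  rewrite -setXTT TF TG predeqE => -[x y]; split.
    move=> [/= [n _ Fnx] [k _ Gky]]; exists (maxn n k) => //; split.
    - by move: x Fnx; exact/subsetPset/ndF/leq_maxl.
    - by move: y Gky; exact/subsetPset/ndG/leq_maxr.
  by move=> [n _ []/= ? ?]; split; exists n.
move=> k; have [? ?] := Foo k; have [? ?] := Goo k.
split; first exact: measurableX.
by rewrite product_measure1E// lte_mul_pinfty// ge0_fin_numE.
Qed.

Definition cons_Rd d (xt : measurableTypeR R * Rd R d) : Rd R d.+1 :=
  [the d.+1.-tuple _ of xt.1 :: xt.2].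

Lemma measurable_cons_Rd d : measurable_fun [set: _] (@cons_Rd d).
Proof. exact: measurable_cons. Qed.

Section step.
Variables (d : nat) (m : {sigma_finite_measure set (Rd R d) -> \bar R}).

Definition lebesgue_Rd_step : set (Rd R d.+1) -> \bar R :=
  pushforward (@lebesgue_measure R \x m) (@cons_Rd d).

Let step0 : lebesgue_Rd_step set0 = 0.
Proof. by rewrite /lebesgue_Rd_step /pushforward preimage_set0 measure0. Qed.

Let step_ge0 A : 0 <= lebesgue_Rd_step A.
Proof. by rewrite /lebesgue_Rd_step /pushforward; exact: measure_ge0. Qed.

Let step_sigma_additive : semi_sigma_additive lebesgue_Rd_step.
Proof.
move=> F mF tF mUF; rewrite /lebesgue_Rd_step /pushforward preimage_bigcup.
have mc A : measurable A -> measurable (@cons_Rd d @^-1` A).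
  by move=> mA; rewrite -[_ @^-1` _]setTI; exact: measurable_cons_Rd.
apply: measure_semi_sigma_additive.
- by move=> n; exact: mc.
- apply/trivIsetP => /= i j _ _ ij; rewrite -preimage_setI.
  by move/trivIsetP : tF => /(_ _ _ _ _ ij) ->//; rewrite preimage_set0.
- by rewrite -preimage_bigcup; exact: mc.
Qed.

HB.instance Definition _ := isMeasure.Build _ _ _ lebesgue_Rd_step
  step0 step_ge0 step_sigma_additive.

Let step_sigma_finite : sigma_finite setT lebesgue_Rd_step.
Proof.
have [F FT Ffin] : sigma_finite setT (@lebesgue_measure R \x m).
  exact: (sigma_finite_product (@lebesgue_measure R)).
pose u (t : Rd R d.+1) : measurableTypeR R * Rd R d :=
  (thead t, [tuple of behead t]).
have cu : cancel (@cons_Rd d) u by move=> [a t]; congr pair; exact/val_inj.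
have uc : cancel u (@cons_Rd d) by move=> t; rewrite [RHS]tuple_eta; exact/val_inj.
have mu : measurable_fun setT u.
  apply/measurable_fun_pairP; split; first exact: measurable_tnth.
  exact: measurable_behead.
exists (fun i => u @^-1` F i); first by rewrite -preimage_bigcup -FT preimage_setT.
move=> i; have [mFi Fifin] := Ffin i; split.
  by rewrite -[_ @^-1` _]setTI; exact: mu.
by rewrite /lebesgue_Rd_step /pushforward -comp_preimage (_ : u \o _ = id)//; apply/funext.
Qed.

HB.instance Definition _ := @Measure_isSigmaFinite.Build _ _ _ lebesgue_Rd_step
  step_sigma_finite.

End step.

(* Lebesgue measure on R^d: the d-fold product of Lebesgue measure on R. *)
Fixpoint lebesgue_Rd (d : nat) : {sigma_finite_measure set (Rd R d) -> \bar R} :=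
  match d with
  | 0 => [the {sigma_finite_measure set (Rd R 0) -> \bar R} of \d_([tuple] : Rd R 0)]
  | d'.+1 => [the {sigma_finite_measure set (Rd R d'.+1) -> \bar R}
              of lebesgue_Rd_step (lebesgue_Rd d')]
  end.

Lemma lebesgue_Rd_box d (A : 'I_d -> set (measurableTypeR R)) :
    (forall i, measurable (A i)) ->
  lebesgue_Rd d [set x | forall i, A i (tnth x i)] =
  \prod_(i < d) lebesgue_measure (A i).
Proof.
elim: d A => [|d IH] A mA.
  rewrite big_ord0 /= diracE; case: (boolP (_ \in _)) => // /negP[].
  by rewrite inE => -[].
rewrite big_ord_recl /= /lebesgue_Rd_step /pushforward.
rewrite (_ : _ @^-1` _ =
    A ord0 `*` [set x | forall i, A (lift ord0 i) (tnth x i)]); last first.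
  apply/seteqP; split=> -[a t] /=.
    move=> H; split; first exact: (H ord0).
    by move=> i; have := H (lift ord0 i); rewrite /cons_Rd/= tnthS.
  move=> [Aa At] i; case: (unliftP ord0 i) => [j|] ->//.
  by rewrite /cons_Rd/= tnthS.
rewrite product_measure1E//; first by rewrite -IH// => i; exact: mA.
rewrite (_ : [set x | _] =
    \bigcap_(i in [set: 'I_d]) ((@tnth d _)^~ i @^-1` A (lift ord0 i))).
  apply: fin_bigcap_measurable => // i _; rewrite -[_ @^-1` _]setTI.
  by apply: measurable_tnth => //; exact: mA.
by apply/seteqP; split=> [x H i _|x H i]; apply: H.
Qed.

End lebesgue_Rd.

Section geometry.
Context {R : realType} {d : nat}.
Implicit Types x y : Rd R d.

Definition eucl_dist x y : R :=
  Num.sqrt (\sum_(i < d) (tnth x i - tnth y i) ^+ 2).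

Definition cball x (tau : R) : set (Rd R d) := [set y | eucl_dist y x <= tau].

(* Tuples carry no topology in the library; compactness is that of the
   corresponding set of row vectors. *)
Definition compact_Rd (S : set (Rd R d)) : Prop :=
  compact ((fun x => \row_i tnth x i : 'rV[R]_d) @` S).

End geometry.

Section pair_law.
Context {R : realType} {d : nat} {dO : measure_display}
  {Omega : measurableType dO} (Q : probability Omega R).
Local Open Scope ereal_scope.

(* The topological support of the law of X. *)
Definition law_support (X : {RV Q >-> Rd R d}) : set (Rd R d) :=
  [set x | forall tau : R, (0 < tau)%R -> 0 < distribution Q X (cball x tau)].

Definition has_density (X : {RV Q >-> Rd R d}) (f : Rd R d -> R) : Prop :=
  [/\ measurable_fun setT f, forall x, (0 <= f x)%R &
      forall A, measurable A ->
        distribution Q X A = \int[lebesgue_Rd d]_(x in A) (f x)%:E].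

(* eta is a version of x |-> Q(Y = 1 | X = x). *)
Definition is_regression_function (X : {RV Q >-> Rd R d}) (Y : {RV Q >-> R})
    (eta : Rd R d -> R) : Prop :=
  measurable_fun setT eta /\
  forall A, measurable A ->
    Q (X @^-1` A `&` Y @^-1` [set 1%R]) =
    \int[distribution Q X]_(x in A) (eta x)%:E.

Definition cond_prob (A B : set Omega) : R :=
  (fine (Q (A `&` B)) / fine (Q B))%R.

(* The classifier g is fixed here; the risk of a sample-dependent classifier
   is obtained by applying this to its realisation, (X, Y) being defined on a
   probability space of its own and hence independent of the sample. *)
Definition balanced_risk (X : {RV Q >-> Rd R d}) (Y : {RV Q >-> R})
    (g : Rd R d -> R) : R :=
  (2^-1 * (cond_prob [set w | g (X w) <> Y w] (Y @^-1` [set 1%R])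
         + cond_prob [set w | g (X w) <> Y w] (Y @^-1` [set (-1)%R])))%R.

End pair_law.

Definition balanced_bayes {R : realType} {d : nat} (p : R) (eta : Rd R d -> R)
    (x : Rd R d) : R :=
  if p <= eta x then 1 else -1.

Section iid_copies.
Context {R : realType} {dO dO' dE : measure_display}
  {Omega : measurableType dO} {Omega' : measurableType dO'}
  {E : measurableType dE} (P : probability Omega R) (Q : probability Omega' R).
Local Open Scope ereal_scope.

(* As A i may be setT, the product rule covers all subfamilies. *)
Definition mutually_independent (I : finType) (Z : I -> Omega -> E) : Prop :=
  forall A : I -> set E, (forall i, measurable (A i)) ->
    P (\bigcap_(i in [set: I]) (Z i @^-1` A i)) = \prod_i P (Z i @^-1` A i).

Definition iid_copies (I : finType) (Z : I -> Omega -> E)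
    (Z0 : Omega' -> E) : Prop :=
  mutually_independent Z /\
  forall i A, measurable A -> P (Z i @^-1` A) = Q (Z0 @^-1` A).

End iid_copies.

Section balanced_knn.
Context {R : realType} {d n : nat} (k : nat).
Variables (xs : 'I_n -> Rd R d) (ys : 'I_n -> R).

Definition p_hat : R := n%:R^-1 * \sum_(i < n) (ys i == 1)%:R.

Definition knn_radius (x : Rd R d) : R :=
  inf [set tau | 0 <= tau /\ k%:R <= \sum_(i < n) \1_(cball x tau) (xs i) :> R].

Definition eta_hat (x : Rd R d) : R :=
  k%:R^-1 *
  \sum_(i < n | xs i \in cball x (knn_radius x)) (ys i == 1)%:R.

Definition balanced_knn (x : Rd R d) : R :=
  if p_hat <= eta_hat x then 1 else -1.

End balanced_knn.

(* Main.v *)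
(* At a fixed point x of the support, let the two deterministic balls centred at x
   have mass (1 - delta) k / n and (1 + delta) k / n; they exist because spheres are
   null for the law of X. With overwhelming probability the k-NN ball lies between
   them, and Chernoff bounds for the four counts of sample points and of positive
   labels in these balls give P(|eta_hat x - eta x| > e p) <= 8 exp(- kappa k p),
   uniformly in x. No uniform (VC) concentration is needed: the excess risk is
   O(e) plus O(1) times the mass of the x at which this fails, and Fubini, Markov
   and Borel-Cantelli bound that mass almost surely, as k p / ln n tends to
   infinity makes exp(- kappa k p) <= n^-2 eventually. *)

Require Import Defs.
From HB Require Import structures.
From mathcomp Require Import all_boot all_order all_algebra.
From mathcomp Require Import all_classical all_reals all_analysis.
From mathcomp Require Import measurable_realfun.
From mathcomp Require Import ring lra.

Set Implicit Arguments.
Unset Strict Implicit.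
Unset Printing Implicit Defensive.
Import Order.TTheory GRing.Theory Num.Theory.
Import numFieldNormedType.Exports.

Local Open Scope classical_set_scope.
Local Open Scope ring_scope.

(** * Chernoff bounds for counts of iid points *)

(** The classifier compares two quantities that both tend to zero, so errors have to be small
    relative to [p]. Among about [k] neighbours only O(k p) carry the label 1, and a bound that
    ignores how rare they are would produce an exponent of order k p^2. Deviations are therefore
    measured against an upper bound of the mean count, which yields k p. That this mean is O(k p)
    rests on a uniform bound |eta| <= M p on the support, obtained by averaging over balls of a
    fixed radius. The hypotheses constrain each sample size separately: samples for distinct [n] may
    depend on one another arbitrarily, and the half of Borel-Cantelli that is used asks for
    summability alone. All pointwise estimates are confined to the support of the law of X, whose
    complement is null. *)

Lemma expR_le_quad (R : realType) (t : R) : t <= 2^-1 ->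
  expR t <= 1 + t + 2 * t ^+ 2.
Proof.
move=> t2; have := expR_ge1Dx (- t); have := expR_gt0 t.
have : expR t * expR (- t) = 1 by rewrite expRxMexpNx_1.
set u := expR t; set v := expR (- t) => uv u0 v1.
(* Both sides are compared after multiplication by 1 - t > 0; the factor 2 in the quadratic term
   makes [h2] hold up to t = 1/2 and for every negative t. *)
have h1 : u * (1 - t) <= 1 by rewrite -[leRHS]uv ler_pM2l.
have h2 : 1 <= (1 + t + 2 * t ^+ 2) * (1 - t).
  have : 0 <= t ^+ 2 * (1 - 2 * t) by rewrite mulr_ge0 ?sqr_ge0//; lra.
  rewrite (_ : (1 + t + _) * _ = 1 + t ^+ 2 * (1 - 2 * t)); [lra|ring].
by rewrite -(@ler_pM2r _ (1 - t)) ?(le_trans h1)//; lra.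
Qed.

Section chernoff.
Context {R : realType} {dO dO' dE : measure_display}
  {Omega : measurableType dO} {Omega' : measurableType dO'}
  {E : measurableType dE} (P : probability Omega R) (Q : probability Omega' R).
Context {I : finType} (Z : I -> Omega -> E) (Z0 : Omega' -> E).
Hypothesis mZ : forall i, measurable_fun setT (Z i).
Hypothesis mZ0 : measurable_fun setT Z0.
Hypothesis iidZ : iid_copies P Q Z Z0.
Variable A : set E.
Hypothesis mA : measurable A.

Definition hits (w : Omega) : {set I} := [set i | Z i w \in A]%SET.

Let q := fine (Q (Z0 @^-1` A)).

Let mZ0A : measurable (Z0 @^-1` A).
Proof. by rewrite -[X in measurable X]setTI; exact: mZ0. Qed.

Let q01 : 0 <= q <= 1.
Proof.
by rewrite fine_ge0//= -lee_fin fineK ?fin_num_measure// probability_le1.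
Qed.

Let cell (J : {set I}) : set Omega :=
  \bigcap_(i in [set: I]) (Z i @^-1` (if i \in J then A else ~` A)).

Let cellE J : cell J = [set w | hits w = J].
Proof.
apply/seteqP; split => w /=.
  move=> h; apply/setP => i; rewrite inE; have /= := h i Logic.I.
  by case: (i \in J) => Aw; [rewrite mem_set|rewrite memNset].
move=> <- i _; rewrite /preimage/= inE.
by case: ifPn; [rewrite inE|rewrite notin_setE].
Qed.

Let mcell J : measurable (cell J).
Proof.
apply: fin_bigcap_measurable => // i _.
rewrite -[X in measurable X]setTI; apply: mZ => //.
by case: ifP => // _; exact: measurableC.
Qed.

Let Pcell J : P (cell J) = (\prod_i (if i \in J then q else 1 - q))%:E.
Proof.
have [ind same] := iidZ.
rewrite /cell ind; last by move=> i; case: ifP => // _; exact: measurableC.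
rewrite -prodEFin; apply: eq_bigr => i _; rewrite same; last first.
  by case: ifP => // _; exact: measurableC.
have qE : (q%:E = Q (Z0 @^-1` A))%E by rewrite /q fineK ?fin_num_measure.
by case: ifP => _; rewrite ?qE// preimage_setC probability_setC// EFinB qE.
Qed.

Lemma measurable_hits (D : pred {set I}) : measurable [set w | D (hits w)].
Proof.
rewrite (_ : [set w | _] = \bigcup_(J in [set J | D J]) cell J).
  by apply: fin_bigcup_measurable => //; exact: finite_finset.
apply/seteqP; split => [w /= Dw|w [J /= DJ]].
  by exists (hits w) => //; rewrite cellE.
by rewrite cellE => /= ->.
Qed.

Lemma probability_hits (D : pred {set I}) :
  P [set w | D (hits w)] =
  (\sum_(J in D) \prod_i (if i \in J then q else 1 - q))%:E.
Proof.
rewrite (_ : [set w | _] = \bigcup_(J in [set` D]) cell J); last first.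
  apply/seteqP; split => [w /= Dw|w [J /= DJ]].
    by exists (hits w) => //; rewrite cellE.
  by rewrite cellE => /= ->.
rewrite measure_fin_bigcup//.
- rewrite fsbig_finite//=.
  rewrite -sumEFin -[in RHS]big_enum/=.
  rewrite [LHS](perm_big (enum D)) /=; last first.
    apply: uniq_perm; rewrite ?enum_uniq// ?finmap.fset_uniq//.
    by move=> J; rewrite in_fset_set// mem_enum; apply/idP/idP; rewrite inE.
  by apply: eq_bigr => J _; rewrite Pcell.
- apply/trivIsetP => J K _ _ JK; rewrite !cellE.
  by apply/seteqP; split => // w [/= -> KJ]; move: JK; rewrite KJ eqxx.
Qed.

(** The centred exponential moment of a binomial variable: [bigA_distr] factors the sum over subsets
    into (q exp t + 1 - q)^|I|, and 1 + u <= exp u together with the quadratic bound controls each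
    factor. *)
Lemma hits_mgf (t : R) : t <= 2^-1 ->
  \sum_(J : {set I}) expR (t * (#|J|%:R - #|I|%:R * q)) *
    \prod_i (if i \in J then q else 1 - q)
  <= expR (#|I|%:R * q * (2 * t ^+ 2)).
Proof.
move=> t2.
under eq_bigr => J _.
  rewrite mulrBr expRD (_ : expR (t * #|J|%:R) = \prod_i (if i \in J then expR t else 1)); last first.
    rewrite -big_mkcond/= prodr_const expRM_natr; congr (_ ^+ _).
  rewrite mulrAC -big_split/=.
  rewrite (eq_bigr (fun i => if i \in J then expR t * q else 1 - q)); last first.
    by move=> i _; case: ifP => // _; rewrite mul1r.
  over.
rewrite -big_distrl/= -(bigA_distr _ _ (fun=> expR t * q) (fun=> 1 - q)).
rewrite prodr_const.
have /andP[q0 q1] := q01.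
have h : expR t * q + (1 - q) <= expR (q * (t + 2 * t ^+ 2)).
  apply: le_trans (expR_ge1Dx _).
  have := ler_wpM2r q0 (expR_le_quad t2); lra.
have -> : #|I|%:R * q * (2 * t ^+ 2) =
  (q * (t + 2 * t ^+ 2)) * #|I|%:R + - (t * (#|I|%:R * q)) by ring.
rewrite expRD expRM_natr ler_pM2r ?expR_gt0//.
apply: lerXn2r => //; rewrite nnegrE ?expR_ge0// addr_ge0//.
  by rewrite mulr_ge0 ?expR_ge0.
by rewrite subr_ge0.
Qed.

(** Exponential tilting by delta / 4 in either direction: [delta <= 2] keeps the tilt below 1/2, and
    the exponent is - delta^2 m / 4 + delta^2 m / 8. The scale [m] only bounds the mean from above,
    because for rare labels the mean may be far smaller than the deviations of interest. *)
Lemma hits_deviation (delta m : R) : 0 <= delta <= 2 -> #|I|%:R * q <= m ->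
  (P [set w | (delta * m <= `| #|hits w|%:R - #|I|%:R * q |)%R] <=
   (2 * expR (- (delta ^+ 2 * m / 8)))%:E)%E.
Proof.
move=> /andP[d0 d2] nqm.
rewrite (probability_hits (fun J => delta * m <= `| #|J|%:R - #|I|%:R * q |)).
rewrite lee_fin.
have m0 : 0 <= m.
  by rewrite (le_trans _ nqm)// mulr_ge0// ?ler0n//; case/andP: q01.
have w0 (J : {set I}) : 0 <= \prod_i (if i \in J then q else 1 - q).
  by apply: prodr_ge0 => i _; case/andP: q01 => ? ?; case: ifP => // _; rewrite subr_ge0.
(* Markov weight of [J] for the upper tail (s = 1) or the lower tail (s = -1). *)
pose B (s : R) (J : {set I}) := expR (- (delta / 4 * (delta * m))) *
  (expR (s * (delta / 4) * (#|J|%:R - #|I|%:R * q)) *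
    \prod_i (if i \in J then q else 1 - q)).
have B0 s J : 0 <= B s J by rewrite /B !mulr_ge0// expR_ge0.
have hB s : `|s| = 1 -> \sum_J B s J <= expR (- (delta ^+ 2 * m / 8)).
  move=> s1; rewrite -mulr_sumr.
  have ss : s ^+ 2 = 1 by rewrite -real_normK ?num_real// s1 expr1n.
  have sd : s * (delta / 4) <= 2^-1.
    rewrite (le_trans (ler_norm _))// normrM s1 mul1r ger0_norm; lra.
  have := hits_mgf sd; rewrite exprMn ss mul1r => h.
  apply: (le_trans (ler_wpM2l (expR_ge0 _) h)).
  rewrite -expRD ler_expR.
  have : #|I|%:R * q * delta ^+ 2 <= m * delta ^+ 2 by rewrite ler_wpM2r// sqr_ge0.
  lra.
rewrite mulr2n mulrDl !mul1r.
apply: le_trans (lerD (hB 1 _) (hB (-1) _)); last 2 first.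
  by rewrite normr1.
  by rewrite normrN1.
rewrite -big_split/= big_mkcond/=; apply: ler_sum => J _.
case: ifPn => [JD|_]; last by rewrite addr_ge0.
have hs s : delta * m <= s * (#|J|%:R - #|I|%:R * q) ->
    \prod_i (if i \in J then q else 1 - q) <= B s J.
  move=> h; rewrite /B mulrA -expRD ler_peMl// -[leLHS]expR0 ler_expR.
  have d4 : 0 <= delta / 4 by lra.
  have := ler_wpM2l d4 h.
  lra.
move: JD; rewrite unfold_in/= ler_normr => /orP[] h.
  by rewrite (le_trans (hs 1 _)) ?mul1r// lerDl.
by rewrite (le_trans (hs (-1) _)) ?mulN1r// lerDr.
Qed.

End chernoff.

(** * Balls and Lebesgue measure *)

Section euclidean.
Context {R : realType} {d : nat}.
Implicit Types x y : Rd R d.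

Lemma measurable_eucl_dist (dT : measure_display) (T : measurableType dT)
    (f g : T -> Rd R d) : measurable_fun setT f -> measurable_fun setT g ->
  measurable_fun setT (fun t => eucl_dist (f t) (g t)).
Proof.
move=> mf mg; apply: (measurableT_comp (f := @Num.sqrt R)).
  apply: nondecreasing_measurable => // a b; exact: ler_wsqrtr.
apply: measurable_sum => i; apply: measurable_funX; apply: measurable_funB.
  exact: (measurableT_comp (measurable_tnth i)).
exact: (measurableT_comp (measurable_tnth i)).
Qed.

Lemma measurable_cball x (tau : R) : measurable (cball x tau).
Proof.
rewrite -[cball _ _]setTI.
apply: (measurable_fun_le (g := cst tau)) => //.
exact: (measurable_eucl_dist (@measurable_id _ _ setT) (measurable_cst x)).
Qed.

Lemma eucl_dist_le_sup x y (e : R) : 0 <= e ->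
  (forall i, `|tnth y i - tnth x i| <= e) ->
  eucl_dist y x <= Num.sqrt d%:R * e.
Proof.
move=> e0 h; rewrite /eucl_dist -[X in _ * X](ger0_norm e0) -sqrtr_sqr -sqrtrM//.
apply: ler_wsqrtr; rewrite mulr_natl -[X in _ *+ X]card_ord -sumr_const.
by apply: ler_sum => i _; rewrite -[leLHS]real_normK ?num_real// lerXn2r// nnegrE.
Qed.

Lemma measurable_box (A : 'I_d -> set (measurableTypeR R)) :
  (forall i, measurable (A i)) ->
  measurable [set x : Rd R d | forall i, A i (tnth x i)].
Proof.
move=> mA; rewrite (_ : [set x | _] =
    \bigcap_(i in [set: 'I_d]) ((fun x : Rd R d => tnth x i) @^-1` A i)).
  apply: fin_bigcap_measurable => // i _; rewrite -[_ @^-1` _]setTI.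
  by apply: measurable_tnth => //; exact: mA.
by apply/seteqP; split=> [x H i _|x H i]; apply: H.
Qed.

(** The ball contains the cube of side 2 e with the same centre; this crude bound spares the exact
    volume of a ball. *)
Lemma lebesgue_cball_ge x (e : R) : 0 < e ->
  (((2 * e) ^+ d)%:E <= lebesgue_Rd d (cball x (Num.sqrt d%:R * e)))%E.
Proof.
move=> e0; pose A (i : 'I_d) : set (measurableTypeR R) :=
  [set` `[tnth x i - e, tnth x i + e]].
have mA i : measurable (A i) by exact: measurable_itv.
apply: (@le_trans _ _ (lebesgue_Rd d [set y : Rd R d | forall i, A i (tnth y i)])); last first.
  apply: le_measure; rewrite ?inE.
  - exact: measurable_box.
  - exact: measurable_cball.
  - move=> y /= h; apply: eucl_dist_le_sup; first exact: ltW.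
    by move=> i; have := h i; rewrite /A/= in_itv/= ler_distl.
rewrite lebesgue_Rd_box//.
rewrite (eq_bigr (fun=> (2 * e)%:E)); last first.
  move=> i _; rewrite /A lebesgue_measure_itv/= lte_fin ifT; last lra.
  by rewrite -EFinB; congr EFin; ring.
by rewrite prodEFin prodr_const card_ord.
Qed.

End euclidean.

(** Every line parallel to the first axis meets a sphere in at most two points. In dimension 0 the
    measure is a point mass, whence [0 < d]. *)
Lemma lebesgue_sphere0 (R : realType) (d : nat) (x : Rd R d) (tau : R) :
  (0 < d)%N -> lebesgue_Rd d [set y | eucl_dist y x = tau] = 0%E.
Proof.
case: d x => [//|d] x _.
have mS : measurable [set y | eucl_dist y x = tau].
  rewrite (_ : [set y | _] = (fun y => eucl_dist y x) @^-1` [set tau])//.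
  rewrite -[X in measurable X]setTI.
  exact: (measurable_eucl_dist (@measurable_id _ _ setT) (measurable_cst x)).
rewrite /= /lebesgue_Rd_step /pushforward.
set B := _ @^-1` _.
have mB : measurable B.
  by rewrite -[B]setTI; exact: (measurable_cons_Rd measurableT).
(* The product in [lebesgue_Rd_step] has its outer integral over the first coordinate; uniqueness of
   the product measure exchanges the order, so that the inner measure is Lebesgue measure on the
   line. *)
rewrite (@product_measure_unique _ _ _ _ _ (lebesgue_measure (R := R)) (lebesgue_Rd d)
  (product_measure2 (lebesgue_measure (R := R)) (lebesgue_Rd d)) _ B mB); last first.
  by move=> A1 A2 mA1 mA2; exact: product_measure2E.
transitivity (\int[lebesgue_Rd d]_y (@lebesgue_measure R (ysection B y)))%E => //.
rewrite (eq_integral (cst 0%E)) ?integral0// => y _ /=.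
apply: countable_lebesgue_measure0.
apply: finite_set_countable.
set s := tau ^+ 2 - \sum_(i < d) (tnth y i - tnth x (lift ord0 i)) ^+ 2.
apply: (@sub_finite_set _ _ [set thead x + Num.sqrt s; thead x - Num.sqrt s]%classic).
  move=> a; rewrite /ysection /= inE /B /= => h.
  have : (a - thead x) ^+ 2 = s.
    rewrite /s -h /eucl_dist sqr_sqrtr; last by apply: sumr_ge0 => i _; exact: sqr_ge0.
    rewrite big_ord_recl /=.
    under [in RHS]eq_bigr do rewrite /cons_Rd tnthS.
    by rewrite addrK.
  move=> h2; have s0 : 0 <= s by rewrite -h2 sqr_ge0.
  have /eqP := h2; rewrite -[X in _ == X]sqr_sqrtr// eqf_sqr => /orP[] /eqP e; [left|right]; rewrite -e; ring.
exact: finite_set2.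
Qed.

(** * Intermediate values of an atomless distribution function *)

Section atomless_cdf.
Context {d : measure_display} {T : measurableType d} {R : realType}
  (Q : probability T R) (D : {RV Q >-> R}).

(** The witness is the infimum [t] of the r with cdf r >= m, which is finite by the limits at both
    infinities. Right continuity gives cdf t >= m. As [t] is not an atom, cdf t is the mass of the
    open half-line, a limit of values below m, so cdf t <= m. *)
Lemma cdf_surjective (m : R) : (forall r, Q (D @^-1` [set r]) = 0%E) ->
  0 < m < 1 -> exists r, cdf D r = m%:E.
Proof.
move=> atomless /andP[m0 m1].
have mono : {homo cdf D : r s / r <= s >-> (r <= s)%E} := cdf_nondecreasing D.
pose E := [set r | (m%:E <= cdf D r)%E].
have [r1 Er1] : E !=set0.
  apply: contrapT => E0.
  have : (lim (cdf D r @[r --> +oo%R]) <= m%:E)%E.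
    apply: lime_le; first by apply/cvg_ex; exists 1%E; exact: cvg_cdfy1.
    apply: nearW => r; rewrite leNgt; apply/negP => /ltW mr; apply: E0.
    by exists r.
  by rewrite (cvg_lim _ (@cvg_cdfy1 _ _ _ _ D))// lee_fin leNgt m1.
have [r0 r0m] : exists r0, (cdf D r0 < m%:E)%E.
  apply: contrapT => h.
  have : (m%:E <= lim (cdf D r @[r --> -oo%R]))%E.
    apply: lime_ge; first by apply/cvg_ex; exists 0%E; exact: cvg_cdfNy0.
    apply: nearW => r; rewrite leNgt; apply/negP => rm; apply: h.
    by exists r.
  by rewrite (cvg_lim _ (@cvg_cdfNy0 _ _ _ _ D))// lee_fin leNgt m0.
have lbE : lbound E r0.
  move=> r /= Er; rewrite leNgt; apply/negP => /ltW /mono.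
  by move=> /(le_trans Er); rewrite leNgt r0m.
have hi : has_inf E by split; [exists r1|exists r0].
pose t := inf E.
have mD A : measurable A -> measurable (D @^-1` A).
  by move=> mA; rewrite -[X in measurable X]setTI; exact: measurable_funPT.
exists t; apply/eqP; rewrite eq_le; apply/andP; split.
  pose F n := D @^-1` `]-oo, t - n.+1%:R^-1]%classic.
  have mF n : measurable (F n) by apply: mD; exact: measurable_itv.
  have UF : \bigcup_n F n = D @^-1` `]-oo, t[%classic.
    apply/seteqP; split => [w [n _]|w]; rewrite /F /preimage /= !in_itv /=.
      by move=> h; rewrite (le_lt_trans h)// ltrBlDr ltrDl invr_gt0.
    move=> /ltr_add_invr[n h]; exists n => //=.
    by rewrite in_itv/= lerBrDr ltW.
  have -> : cdf D t = Q (\bigcup_n F n).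
    rewrite UF -(measureU0 _ _ (atomless t)); last 2 first.
    - by apply: mD; exact: measurable_itv.
    - exact: mD.
    rewrite /cdf /distribution /pushforward; congr (Q _).
    apply/seteqP; split => w; rewrite /preimage /= !in_itv /=.
      by rewrite le_eqVlt => /predU1P[->|]; [right|left].
    by case=> [/ltW//|->].
  have cv : (Q \o F) n @[n --> \oo] --> Q (\bigcup_n F n).
    apply: nondecreasing_cvg_mu => //; first exact: bigcup_measurable.
    move=> n k nk; apply/subsetPset => w; rewrite /F /preimage/= !in_itv/=.
    move=> /le_trans; apply; rewrite lerD2l lerN2 lef_pV2 ?posrE// ler_nat.
    by rewrite ltnS.
  rewrite -(cvg_lim _ cv)//.
  apply: lime_le; first by apply/cvg_ex; eexists; exact: cv.
  apply: nearW => n; rewrite leNgt; apply/negP => h.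
  have /(ge_inf hi.2) : E (t - n.+1%:R^-1) by exact: ltW.
  by rewrite -/t lerBrDl gerDr leNgt invr_gt0 ltr0n.
rewrite -(cvg_lim _ (@cdf_right_continuous _ _ _ _ D t))//.
apply: lime_ge; first by apply/cvg_ex; eexists; exact: cdf_right_continuous.
near=> r; have /(inf_lt hi.1)[s /= Es sr] : t < r by near: r; exact: nbhs_right_gt.
by rewrite (le_trans Es)// mono// ltW.
Unshelve. all: by end_near. Qed.

End atomless_cdf.

(** * The law of X *)

Section law.
Context {R : realType} {d : nat} {dO : measure_display}
  {Omega : measurableType dO} (Q : probability Omega R).
Variable X : {RV Q >-> Rd R d}.
Local Notation mu := (distribution Q X).
Local Notation S := (law_support X).

Lemma measurable_law_preimage (A : set (Rd R d)) :
  measurable A -> measurable (X @^-1` A).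
Proof. by move=> mA; rewrite -[_ @^-1` _]setTI; exact: measurable_funPT. Qed.

(** Radii 1/(n+1) suffice, and for each of them the mass of the ball around x is measurable in x,
    being the measure of the sections of a measurable set of pairs. *)
Lemma measurable_law_support : measurable S.
Proof.
have -> : S = \bigcap_n [set x | (0 < mu (cball x n.+1%:R^-1))%E].
  apply/seteqP; split => [x Sx n _ /=|x h tau tau0]; first exact: Sx.
  have /ltr_add_invr[n] := tau0; rewrite add0r => ntau.
  apply: (lt_le_trans (h n Logic.I)); apply: le_measure; rewrite ?inE.
  - exact: measurable_cball.
  - exact: measurable_cball.
  - by move=> y /= /le_trans; apply; exact: ltW.
apply: bigcap_measurable => // n _.
pose A := [set z : Rd R d * Rd R d | eucl_dist z.2 z.1 <= n.+1%:R^-1].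
have mA : measurable A.
  rewrite -[A]setTI; apply: (measurable_fun_le (g := cst n.+1%:R^-1)) => //.
  exact: (measurable_eucl_dist (@measurable_snd _ _ _ _) (@measurable_fst _ _ _ _)).
have mphi := measurable_fun_xsection mu mA.
rewrite (_ : [set x | _] = (mu \o xsection A) @^-1` `]0%E, +oo[%classic).
  rewrite -[_ @^-1` _]setTI; apply: mphi => //; exact: emeasurable_itv.
have xA x : xsection A x = cball x n.+1%:R^-1.
  by apply/seteqP; split => y; rewrite /xsection/= inE.
apply/seteqP; split => x; rewrite /preimage/= in_itv/= xA ?andbT//.
Qed.

(** A point off the support lies in a null cube with rational centre and half-width 1/(k+1), and
    there are countably many such cubes. *)
Lemma law_support_compl0 : mu (~` S) = 0%E.
Proof.
pose box (b : d.-tuple rat * nat) : set (Rd R d) :=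
  [set y | forall i, `|tnth y i - ratr (tnth b.1 i)| <= b.2.+1%:R^-1].
have mbox b : measurable (box b).
  rewrite (_ : box b = [set y | forall i, [set` `[ratr (tnth b.1 i) - b.2.+1%:R^-1,
     ratr (tnth b.1 i) + b.2.+1%:R^-1]] (tnth y i)]).
    by apply: (@measurable_box _ _ (fun i => [set` `[ratr (tnth b.1 i) - b.2.+1%:R^-1, ratr (tnth b.1 i) + b.2.+1%:R^-1]])) => i; exact: measurable_itv.
  by apply/seteqP; split => y /= h i; have := h i; rewrite /= in_itv/= ler_distl.
pose F n : set (Rd R d) := if unpickle n is Some b then
  if mu (box b) == 0%E then box b else set0 else set0.
apply/negligibleP; first by apply: measurableC; exact: measurable_law_support.
apply: (negligibleS (A := \bigcup_n F n)); last first.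
  apply: negligible_bigcup => n; rewrite /F.
  case: unpickle => [b|]; last exact: negligible_set0.
  case: eqP => [b0|_]; last exact: negligible_set0.
  exists (box b); split => //.
move=> x /= /existsNP[tau /not_implyP[tau0 /negP]]; rewrite -leNgt => xtau.
(* Two points of a cube of half-width e are at distance at most 2 sqrt(d) e, hence less than [tau]
   for the e chosen below; the + 1 keeps the divisor positive in every dimension. *)
have d0 : 0 < Num.sqrt d%:R * 2 + 1 :> R.
  by rewrite ltr_wpDl// mulr_ge0// sqrtr_ge0.
have : 0 < tau / (Num.sqrt d%:R * 2 + 1) by rewrite divr_gt0.
move=> /ltr_add_invr[k]; rewrite add0r; set e := _^-1 => ek.
have e0 : 0 < e by rewrite invr_gt0.
have h i : exists q : rat, `|tnth x i - ratr q| <= e.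
  have [|q] := @rat_in_itvoo R (tnth x i) (tnth x i + e); first by rewrite ltrDl.
  rewrite in_itv/= => /andP[q1 q2]; exists q.
  by rewrite distrC ger0_norm ?subr_ge0 ?ltW//; lra.
pose q := [tuple xchoose (h i) | i < d].
exists (pickle (q, k)) => //; rewrite /F pickleK.
have xq : box (q, k) x by move=> i; rewrite tnth_mktuple; exact: (xchooseP (h i)).
rewrite ifT//; rewrite eq_le measure_ge0 andbT (le_trans _ xtau)//.
apply: le_measure; rewrite ?inE//; first exact: measurable_cball.
move=> y yq; apply: (@le_trans _ _ (Num.sqrt d%:R * (e * 2))).
  apply: eucl_dist_le_sup; first by rewrite mulr_ge0// ltW.
  move=> i; rewrite mulr2n mulrDr mulr1.
  have -> : tnth y i - tnth x i = (tnth y i - ratr (tnth q i)) - (tnth x i - ratr (tnth q i)) by ring.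
  by rewrite (le_trans (ler_normB _ _))// lerD.
move: ek; rewrite ltr_pdivlMr// => /ltW; apply: le_trans.
by rewrite mulrDr mulr1; have := sqrtr_ge0 (d%:R : R); nra.
Qed.

Context (f : Rd R d -> R).
Hypothesis hf : has_density X f.

(** The wanted radius is a quantile of the distance from X to [x]. *)
Lemma law_cball_surjective (x : Rd R d) (m : R) : (0 < d)%N -> 0 < m < 1 ->
  exists tau, mu (cball x tau) = m%:E.
Proof.
move=> d0 m01; have [mf f0 muE] := hf.
have mD : measurable_fun setT (fun w => eucl_dist (X w) x).
  apply: (measurable_eucl_dist _ (measurable_cst x)).
  exact: measurable_funPT.
pose D : {RV Q >-> R} := mfun_Sub (mem_set mD).
have [|tau cdfD] := @cdf_surjective _ _ _ Q D m _ m01.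
  move=> r.
  have mS : measurable [set y : Rd R d | eucl_dist y x = r].
    rewrite (_ : [set y | _] = (fun y => eucl_dist y x) @^-1` [set r])//.
    rewrite -[X in measurable X]setTI.
    by apply: (measurable_eucl_dist (@measurable_id _ _ setT) (measurable_cst x)).
  have := muE _ mS; rewrite null_set_integral//.
    by apply/measurable_EFinP; exact: measurable_funTS.
  exact: lebesgue_sphere0.
exists tau; rewrite -cdfD /cdf /distribution /pushforward; congr (Q _).
Qed.

(** The bound must not depend on [x]. Regularity of the support supplies Lebesgue volume for radii
    up to [T], hence the truncation of [r], and the lower bound on the density turns volume into
    mass. *)
Lemma law_cball_ge (c T b r : R) : 0 < c -> 0 < T ->
  (forall (x : Rd R d) (tau : R), S x -> 0 < tau <= T ->
     (c%:E * lebesgue_Rd d (cball x tau) <=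
      lebesgue_Rd d (S `&` cball x tau))%E) ->
  0 < b -> (forall x, S x -> b <= f x) -> 0 < r ->
  exists2 m : R, 0 < m & forall x, S x -> (m%:E <= mu (cball x r))%E.
Proof.
move=> c0 T0 hc b0 bf r0; have [mf f0 muE] := hf.
pose t := Num.min r T.
have t0 : 0 < t by rewrite lt_min r0.
pose e := t / (Num.sqrt d%:R + 1).
have s1 : 0 < Num.sqrt d%:R + 1 :> R by rewrite ltr_wpDl ?sqrtr_ge0.
have e0 : 0 < e by rewrite divr_gt0.
exists (b * (c * (2 * e) ^+ d)); first by rewrite !mulr_gt0// exprn_gt0// mulr_gt0.
move=> x Sx.
have mB tau : measurable (S `&` cball x tau).
  by apply: measurableI; [exact: measurable_law_support|exact: measurable_cball].
have h1 : (mu (S `&` cball x t) <= mu (cball x r))%E.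
  apply: le_measure; rewrite ?inE; [exact: mB|exact: measurable_cball|].
  by move=> y [_ /= /le_trans]; apply; rewrite ge_min lexx.
apply: le_trans h1; rewrite muE//.
apply: (@le_trans _ _ (\int[lebesgue_Rd d]_(x in S `&` cball x t) b%:E)%E); last first.
  apply: ge0_le_integral => //.
  - by move=> y _; rewrite lee_fin ltW.
  - by apply/measurable_EFinP; exact: measurable_funTS.
  - by move=> y [Sy _]; rewrite lee_fin bf.
rewrite integral_cst// EFinM lee_wpmul2l//; first by rewrite lee_fin ltW.
apply: le_trans (hc _ t Sx _); last by rewrite t0 ge_min lexx orbT.
rewrite EFinM lee_wpmul2l//; first by rewrite lee_fin ltW.
apply: (le_trans (lebesgue_cball_ge x e0)); apply: le_measure; rewrite ?inE.
- exact: measurable_cball.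
- exact: measurable_cball.
move=> y /= /le_trans; apply; rewrite /e mulrA ler_pdivrMr//.
by rewrite mulrC ler_wpM2l ?ltW// ltrDl.
Qed.

End law.

(** * Balanced risk and regression function *)

Lemma fine_measureD {R : realType} {d : measure_display} {T : measurableType d}
    (Q : probability T R) (A B : set T) : measurable A -> measurable B ->
  fine (Q (A `\` B)) = fine (Q A) - fine (Q (A `&` B)).
Proof.
move=> mA mB; rewrite (measureDI Q mA mB) fineD ?addrK//.
- by rewrite fin_num_measure//; exact: measurableD.
- by rewrite fin_num_measure//; exact: measurableI.
Qed.

Section regression.
Context {R : realType} {d : nat} {dO : measure_display}
  {Omega : measurableType dO} (Q : probability Omega R).
Variables (X : {RV Q >-> Rd R d}) (Y : {RV Q >-> R}) (eta : Rd R d -> R).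
Hypothesis heta : is_regression_function X Y eta.
Local Notation mu := (distribution Q X).
Local Notation S := (law_support X).

Definition mass (A : set (Rd R d)) : R := fine (mu A).
Definition mass1 (A : set (Rd R d)) : R :=
  fine (Q (X @^-1` A `&` Y @^-1` [set 1])).

Let mY1 : measurable (Y @^-1` [set 1]).
Proof. by rewrite -[_ @^-1` _]setTI; exact: measurable_funPT. Qed.

Let mXY1 A : measurable A -> measurable (X @^-1` A `&` Y @^-1` [set 1]).
Proof. by move=> mA; apply: measurableI => //; exact: measurable_law_preimage. Qed.

Lemma massE A : measurable A -> (mass A)%:E = mu A.
Proof. by move=> mA; rewrite /mass fineK// fin_num_measure. Qed.

Lemma mass1E A : measurable A ->
  (mass1 A)%:E = Q (X @^-1` A `&` Y @^-1` [set 1]).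
Proof. by move=> mA; rewrite /mass1 fineK// fin_num_measure//; exact: mXY1. Qed.

Lemma mass_ge0 A : 0 <= mass A. Proof. exact: fine_ge0. Qed.

Lemma mass1_ge0 A : 0 <= mass1 A. Proof. exact: fine_ge0. Qed.

Lemma massD A B : measurable A -> measurable B ->
  mass A = mass (A `&` B) + mass (A `\` B).
Proof.
move=> mA mB; apply: EFin_inj; rewrite EFinD !massE//; last 2 first.
- exact: measurableD.
- exact: measurableI.
by rewrite addrC -measureDI.
Qed.

Lemma mass1D A B : measurable A -> measurable B ->
  mass1 A = mass1 (A `&` B) + mass1 (A `\` B).
Proof.
move=> mA mB; apply: EFin_inj; rewrite EFinD !mass1E//; last 2 first.
- exact: measurableD.
- exact: measurableI.
rewrite addrC (measureDI _ (mXY1 mA) (measurable_law_preimage X mB)).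
congr (Q _ + Q _)%E.
  by rewrite !setDE preimage_setI preimage_setC setIAC.
by rewrite preimage_setI setIAC.
Qed.

Lemma mass1_le A : measurable A -> mass1 A <= mass A.
Proof.
move=> mA; rewrite -lee_fin massE// mass1E//; apply: le_measure; rewrite ?inE.
- exact: mXY1.
- exact: measurable_law_preimage.
- exact: subIsetl.
Qed.

Lemma le_mass A B : measurable A -> measurable B -> A `<=` B -> mass A <= mass B.
Proof. by move=> mA mB AB; rewrite -lee_fin !massE// le_measure ?inE. Qed.

Lemma mass_le1 A : measurable A -> mass A <= 1.
Proof. by move=> mA; rewrite -lee_fin massE// probability_le1. Qed.

Lemma mass1_le1 A : measurable A -> mass1 A <= fine (Q (Y @^-1` [set 1])).
Proof.
move=> mA; rewrite -lee_fin mass1E// fineK ?fin_num_measure//.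
by apply: le_measure; rewrite ?inE//; exact: mXY1.
Qed.

(** [eta] is known through its integrals only, with no pointwise bound by 0 and 1. On either half of
    the splitting by its sign, the integral of |eta| is, up to sign, the probability of an event. *)
Lemma integrable_regression : mu.-integrable setT (EFin \o eta).
Proof.
have [meta etaE] := heta.
have mEeta : measurable_fun setT (EFin \o eta) by exact/measurable_EFinP.
apply/integrableP; split => //.
pose A := [set x | 0 <= eta x].
have mA : measurable A.
  by rewrite -[A]setTI; apply: (measurable_fun_le (f := cst 0)).
have mAC : measurable (~` A) by exact: measurableC.
rewrite -(setUv A) ge0_integral_setU//; last 2 first.
- by rewrite setUv; exact: measurableT_comp.
- by rewrite disj_set2E setICr eqxx.
apply: lte_add_pinfty.
  rewrite (eq_integral (fun x => (eta x)%:E)); last first.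
    by move=> x; rewrite inE => Ax /=; rewrite ger0_norm.
  by rewrite -etaE// -mass1E// ltry.
rewrite (eq_integral (fun x => - (eta x)%:E)%E); last first.
  move=> x; rewrite inE => /negP Ax /=; rewrite ltr0_norm// ltNge//.
have -> : (\int[mu]_(x in ~` A) - (eta x)%:E = - \int[mu]_(x in ~` A) (eta x)%:E)%E.
  rewrite -[LHS]oppeK -integral_ge0N; last first.
    by move=> x /negP; rewrite -ltNge => /ltW; rewrite lee_fin oppr_ge0.
  by congr (- _)%E; apply: eq_integral => x _; rewrite oppeK.
by rewrite -etaE// -mass1E// ltry.
Qed.

Let mS := measurable_law_support X.

(** Allows the pointwise bounds below to be required on the support only, where the Lipschitz
    hypothesis lives. *)
Let massS A : measurable A -> mass A = mass (A `&` S) /\ mass1 A = mass1 (A `&` S).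
Proof.
move=> mA; have mAS : measurable (A `\` S) by exact: measurableD.
have m0 : mass (A `\` S) = 0.
  apply/eqP; rewrite eq_le mass_ge0 andbT.
  have -> : 0 = mass (~` S) by rewrite /mass law_support_compl0.
  by apply: le_mass; [|exact: measurableC|move=> x []].
have m10 : mass1 (A `\` S) = 0.
  by apply/eqP; rewrite eq_le mass1_ge0 andbT -m0 mass1_le.
by rewrite (massD mA mS) (mass1D mA mS) m0 m10 !addr0.
Qed.

Lemma mass1_le_cst A C : measurable A -> (forall x, S x -> A x -> eta x <= C) ->
  mass1 A <= C * mass A.
Proof.
move=> mA hC; have [-> ->] := massS mA.
have [meta etaE] := heta.
have mAS : measurable (A `&` S) by exact: measurableI.
rewrite -lee_fin EFinM massE// mass1E// etaE// -integral_cst//.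
apply: (@le_integral _ _ _ mu _ mAS).
- by apply: (integrableS measurableT mAS _ integrable_regression).
- exact: finite_measure_integrable_cst.
- by move=> x; rewrite inE => -[Ax Sx]; rewrite lee_fin hC.
Qed.

Lemma mass1_ge_cst A C : measurable A -> (forall x, S x -> A x -> C <= eta x) ->
  C * mass A <= mass1 A.
Proof.
move=> mA hC; have [-> ->] := massS mA.
have [meta etaE] := heta.
have mAS : measurable (A `&` S) by exact: measurableI.
rewrite -lee_fin EFinM massE// mass1E// etaE// -integral_cst//.
apply: (@le_integral _ _ _ mu _ mAS).
- exact: finite_measure_integrable_cst.
- by apply: (integrableS measurableT mAS _ integrable_regression).
- by move=> x; rewrite inE => -[Ax Sx]; rewrite lee_fin hC.
Qed.

Let p := fine (Q (Y @^-1` [set 1])).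

Lemma regression_ball_bounds (x : Rd R d) (r C : R) :
  (forall y, S y -> cball x r y -> `|eta y - eta x| <= C) ->
  (eta x - C) * mass (cball x r) <= mass1 (cball x r)
   <= (eta x + C) * mass (cball x r).
Proof.
move=> lip; have mB := measurable_cball x r.
apply/andP; split.
  apply: mass1_ge_cst => // y Sy By.
  by have := lip y Sy By; rewrite ler_distlC => /andP[? ?]; lra.
apply: mass1_le_cst => // y Sy By.
by have := lip y Sy By; rewrite ler_distlC => /andP[? ?]; lra.
Qed.

Hypothesis p01 : 0 < p < 1.
Hypothesis Y2 : forall w, Y w = 1 \/ Y w = -1.

(** With the risk affine in the two masses of {g = 1}, the common part of two decision regions
    cancels in a difference of risks. *)
Lemma balanced_riskE (g : Rd R d -> R) :
  measurable [set x | g x = 1] -> (forall x, g x = 1 \/ g x = -1) ->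
  balanced_risk X Y g = 2^-1 * ((p - mass1 [set x | g x = 1]) / p
    + (mass [set x | g x = 1] - mass1 [set x | g x = 1]) / (1 - p)).
Proof.
move=> mG g2; set G := [set x | g x = 1].
have n11 : (1 : R) <> -1 by apply/eqP; rewrite gt_eqF//; lra.
have hG x : ~ G x -> g x = -1 by case: (g2 x).
have hpos : Q (Y @^-1` [set (-1)%R]) = (1 - p)%:E.
  have -> : Y @^-1` [set (-1)%R] = ~` (Y @^-1` [set 1]).
    apply/seteqP; split => w; rewrite /preimage/=; last by case: (Y2 w).
    by move=> -> /esym.
  by rewrite probability_setC// EFinB /p fineK ?fin_num_measure.
rewrite /balanced_risk /cond_prob hpos /=; congr (_ * (_ / _ + _ / _)).
- rewrite (_ : _ `&` _ = Y @^-1` [set 1] `\` (X @^-1` G)).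
    rewrite fine_measureD//; last exact: measurable_law_preimage.
    by congr (_ - fine (Q _)); exact: setIC.
  apply/seteqP; split => w; rewrite /preimage/=.
    by move=> [+ Y1]; rewrite Y1.
  by move=> [Y1 /hG ->]; rewrite Y1; split => // /esym.
- rewrite (_ : _ `&` _ = (X @^-1` G) `\` (Y @^-1` [set 1])).
    by rewrite fine_measureD//; exact: measurable_law_preimage.
  apply/seteqP; split => w; rewrite /preimage/=.
    move=> [+ Y1]; rewrite Y1 => gX; split; last by move/esym.
    by case: (g2 (X w)).
  move=> [gX Y1]; case: (Y2 w) => // Ym1; split => //.
  by rewrite Ym1 /G/= in gX *; rewrite gX.
Qed.

(* The excess risk is the integral of [|p - eta| / (p (1 - p))] (up to a factor 2)
   over the set where [g] disagrees with the Bayes classifier; this integrand is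
   [O(e)] off [bad] and bounded on [bad]. *)
Lemma balanced_excess_bound (g : Rd R d -> R) (bad : set (Rd R d)) (M e : R) :
  measurable [set x | g x = 1] -> (forall x, g x = 1 \/ g x = -1) ->
  measurable bad -> 0 <= M -> 0 <= e ->
  (forall x, S x -> `|eta x| <= M * p) ->
  (forall x, S x -> ~ bad x -> g x <> balanced_bayes p eta x ->
     `|eta x - p| <= e * p) ->
  0 <= balanced_risk X Y g - balanced_risk X Y (balanced_bayes p eta) <=
    (e + (M + 1) * mass bad) / (1 - p).
Proof.
move=> mG g2 mbad M0 e0 etaM small.
have /andP[p0 p1] := p01.
set G := [set x | g x = 1] in mG *.
pose B := [set x | p <= eta x].
have mB : measurable B.
  by rewrite -[B]setTI; apply: (measurable_fun_le (f := cst p)) => //; case: heta.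
have n11 : (1 : R) <> -1 by apply/eqP; rewrite gt_eqF//; lra.
have BE : [set x | balanced_bayes p eta x = 1] = B.
  apply/seteqP; split => x; rewrite /balanced_bayes /B/=; case: ifP => //.
  by move=> _ /esym.
rewrite !balanced_riskE//; last 2 first.
- by rewrite BE.
- by move=> x; rewrite /balanced_bayes; case: ifP; [left|right].
rewrite BE -/G.
have mGB : measurable (G `\` B) by exact: measurableD.
have mBG : measurable (B `\` G) by exact: measurableD.
(* Off [bad], [eta] is within e p of [p]; on [bad], the two terms are bounded separately by M p and
   p times its mass. The resulting factor [p] compensates the 1 / p of the risk. *)
have nearp A : measurable A -> (forall x, A x -> g x <> balanced_bayes p eta x) ->
    `|mass1 A - p * mass A| <= (e + (M + 1) * mass bad) * p.
  move=> mA Adis.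
  have m1 : measurable (A `&` bad) by exact: measurableI.
  have m2 : measurable (A `\` bad) by exact: measurableD.
  have a1 : mass (A `&` bad) <= mass bad by apply: le_mass => // x [].
  have a0 := mass_ge0 (A `&` bad).
  have b1 := mass_le1 m2; have b0 := mass_ge0 (A `\` bad).
  have u1 : mass1 (A `&` bad) <= M * p * mass (A `&` bad).
    by apply: mass1_le_cst => // x Sx _; rewrite (le_trans (ler_norm _))// etaM.
  have l1 := mass1_ge0 (A `&` bad).
  have u2 : mass1 (A `\` bad) <= (p + e * p) * mass (A `\` bad).
    apply: mass1_le_cst => // x Sx [Ax nbad].
    by have := small x Sx nbad (Adis x Ax); rewrite ler_distlC => /andP[]; lra.
  have l2 : (p - e * p) * mass (A `\` bad) <= mass1 (A `\` bad).
    apply: mass1_ge_cst => // x Sx [Ax nbad].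
    by have := small x Sx nbad (Adis x Ax); rewrite ler_distlC => /andP[]; lra.
  rewrite (massD mA mbad) (mass1D mA mbad) ler_norml.
  have c1 : M * p * mass (A `&` bad) <= M * p * mass bad.
    by rewrite ler_wpM2l// mulr_ge0// ltW.
  have c2 : p * mass (A `&` bad) <= p * mass bad by rewrite ler_wpM2l// ltW.
  have c3 : e * p * mass (A `\` bad) <= e * p.
    by rewrite ler_piMr// mulr_ge0// ltW.
  have c4 : 0 <= p * mass (A `&` bad) by rewrite mulr_ge0// ltW.
  have c5 : 0 <= M * p * mass bad by rewrite !mulr_ge0// ?mass_ge0// ltW.
  by apply/andP; split; lra.
(* Optimality of the Bayes rule: [eta] is at least [p] on [B] and below [p] off it, so both terms of
   the excess are nonnegative. *)
have hB : p * mass (B `\` G) <= mass1 (B `\` G).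
  by apply: mass1_ge_cst => // x _ [].
have hG : mass1 (G `\` B) <= p * mass (G `\` B).
  by apply: mass1_le_cst => // x _ [_ /negP]; rewrite -ltNge => /ltW.
have eB : `|mass1 (B `\` G) - p * mass (B `\` G)| <= (e + (M + 1) * mass bad) * p.
  apply: nearp => // x [Bx Gx]; rewrite /balanced_bayes ifT//.
have eG : `|mass1 (G `\` B) - p * mass (G `\` B)| <= (e + (M + 1) * mass bad) * p.
  apply: nearp => // x [Gx Bx]; rewrite /balanced_bayes ifF//; last exact/negP.
  by rewrite Gx.
move: eB eG; rewrite !ler_norml => /andP[_ eB] /andP[eG _].
rewrite (massD mG mB) (massD mB mG) (mass1D mG mB) (mass1D mB mG) (setIC B G).
set x := mass1 (G `\` B) in hG eG *; set x' := mass1 (B `\` G) in hB eB *.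
set y := mass (G `\` B) in hG eG *; set y' := mass (B `\` G) in hB eB *.
set u := mass1 (G `&` B); set v := mass (G `&` B).
rewrite (_ : _ - _ = 2^-1 * ((x' - p * y') + (p * y - x)) / (p * (1 - p))); last first.
  by field; rewrite !gt_eqF//; lra.
have p1' : 0 < 1 - p by lra.
rewrite divr_ge0 ?mulr_ge0//=; [|lra|lra|lra].
rewrite ler_pdivrMr ?mulr_gt0// (_ : _ / (1 - p) * _ = (e + (M + 1) * mass bad) * p).
  lra.
by field; rewrite gt_eqF.
Qed.

(** The average of [eta] over a ball of mass at least m lies between 0 and p / m, because the ball
    carries at most the mass p of all positive labels. The Lipschitz bound passes from the average
    to the centre at the cost of L r p. *)
Lemma regression_bounded (L r m : R) : 0 < r -> 0 < m -> 0 <= L ->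
  (forall x y, S x -> S y -> `|eta x / p - eta y / p| <= L * eucl_dist x y) ->
  (forall x, S x -> (m%:E <= mu (cball x r))%E) ->
  forall x, S x -> `|eta x| <= (L * r + m^-1) * p.
Proof.
move=> r0 m0 L0 lip mr x Sx; have /andP[p0 p1] := p01.
have mB := measurable_cball x r.
have lip' y : S y -> cball x r y -> `|eta y - eta x| <= L * p * r.
  move=> Sy By; have := lip y x Sy Sx; rewrite -mulrBl normrM.
  have ip : 0 < p^-1 by rewrite invr_gt0.
  rewrite (gtr0_norm ip) ler_pdivrMr// => /le_trans; apply.
  by rewrite mulrAC ler_wpM2l// mulr_ge0// ltW.
have /andP[lo hi] := regression_ball_bounds lip'.
have mm : m <= mass (cball x r) by rewrite -lee_fin massE// mr.
have m1 := mass1_le1 mB.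
have m2 := mass1_ge0 (cball x r).
rewrite -/p in m1.
set b := mass _ in mm lo hi m1; set a := mass1 _ in lo hi m1 m2.
have b0 : 0 < b by exact: lt_le_trans mm.
have lo' : eta x - L * p * r <= m^-1 * p.
  rewrite [m^-1 * p]mulrC ler_pdivlMr//.
  have [neg|pos] := lerP (eta x - L * p * r) 0.
    by rewrite (le_trans (mulr_le0_ge0 neg (ltW m0)))// ltW.
  by apply: le_trans m1; apply: le_trans lo; rewrite ler_wpM2l// ltW.
have hi' : 0 <= eta x + L * p * r.
  by rewrite -(pmulr_lge0 _ b0) (le_trans m2).
have im : 0 <= m^-1 * p by rewrite mulr_ge0// ?invr_ge0 ltW.
by rewrite ler_norml; apply/andP; split; lra.
Qed.

End regression.

(** * The k-NN estimator *)

Section knn.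
Context {R : realType} {d n : nat} (k : nat).
Variables (xs : 'I_n -> Rd R d) (ys : 'I_n -> R).
Hypothesis kn : (0 < k <= n)%N.

Definition ball_count (x : Rd R d) (tau : R) : R :=
  \sum_(i < n) \1_(cball x tau) (xs i).

Definition ball_count1 (x : Rd R d) (tau : R) : R :=
  \sum_(i < n | xs i \in cball x tau) (ys i == 1)%:R.

Let radii (x : Rd R d) := [set tau | 0 <= tau /\ k%:R <= ball_count x tau].

Lemma cballE (x y : Rd R d) (tau : R) : (y \in cball x tau) = (eucl_dist y x <= tau).
Proof. by apply/idP/idP; rewrite inE. Qed.

Lemma eucl_dist_ge0 (x y : Rd R d) : 0 <= eucl_dist x y.
Proof. exact: sqrtr_ge0. Qed.

Lemma le_ball_count x : {homo ball_count x : s t / s <= t}.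
Proof.
move=> s t st; apply: ler_sum => i _; rewrite !indicE !cballE ler_nat.
by case: (leP _ s) => // /le_trans -/(_ _ st) ->.
Qed.

Let radii_lb x : lbound (radii x) 0.
Proof. by move=> tau []. Qed.

Let has_inf_radii x : has_inf (radii x).
Proof.
split; last by exists 0; exact: radii_lb.
(* The sum of all distances dominates each of them, so this ball contains the whole sample, and k <=
   n. *)
exists (\sum_(i < n) eucl_dist (xs i) x); split => /=.
  by apply: sumr_ge0 => i _; exact: eucl_dist_ge0.
rewrite /ball_count (eq_bigr (fun=> 1)); last first.
  move=> i _; rewrite indicE cballE (bigD1 i)//= lerDl sumr_ge0// => j _.
  exact: eucl_dist_ge0.
by rewrite sumr_const card_ord ler_nat; case/andP: kn.
Qed.

Lemma ge_knn_radius x tau : 0 <= tau -> k%:R <= ball_count x tau ->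
  knn_radius k xs x <= tau.
Proof. by move=> t0 kt; apply: ge_inf => //; exists 0; exact: radii_lb. Qed.

Lemma le_knn_radius x tau : ball_count x tau < k%:R -> tau <= knn_radius k xs x.
Proof.
move=> tk; apply: lb_le_inf; first by have [] := has_inf_radii x.
move=> s [s0 ks]; rewrite leNgt; apply/negP => /ltW /(le_ball_count x).
by move=> /(le_trans ks); rewrite leNgt tk.
Qed.

(** The k-NN ball lies between the two given balls and counts of positive labels are monotone. The
    normalisation is k even when ties put more than k points into the k-NN ball, so no tie-breaking
    is involved. *)
Lemma eta_hat_sandwich x s t : ball_count x s < k%:R -> 0 <= t ->
  k%:R <= ball_count x t ->
  ball_count1 x s <= k%:R * eta_hat k xs ys x <= ball_count1 x t.
Proof.
move=> /le_knn_radius st t0 /(ge_knn_radius t0) rt.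
have k0 : k%:R != 0 :> R by rewrite pnatr_eq0 -lt0n; case/andP: kn.
have mono a b : a <= b -> ball_count1 x a <= ball_count1 x b.
  move=> ab; rewrite /ball_count1 big_mkcond [leRHS]big_mkcond/=.
  apply: ler_sum => i _; rewrite !cballE.
  by case: (leP _ a) => [/le_trans -/(_ _ ab) ->//|_]; case: ifP.
by rewrite /eta_hat mulrA divff// mul1r; apply/andP; split; exact: mono.
Qed.

(* This form, free of the infimum, makes the measurability of [eta_hat] visible. *)
Lemma in_knn_ball x i : (xs i \in cball x (knn_radius k xs x)) =
  (\sum_(j < n) (eucl_dist (xs j) x < eucl_dist (xs i) x)%R%:R < k%:R :> R).
Proof.
set r := knn_radius k xs x; rewrite cballE.
pose D j := eucl_dist (xs j) x; rewrite -/(D i).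
apply/idP/idP => [Dir|]; last first.
  move=> lt; apply: lb_le_inf; first by have [] := has_inf_radii x.
  move=> s [s0 ks]; rewrite leNgt; apply/negP => sD.
  move: lt; rewrite ltNge => /negP; apply; apply: (le_trans ks).
  apply: ler_sum => j _; rewrite indicE cballE ler_nat.
  by case: (leP (eucl_dist (xs j) x)) => // /le_lt_trans -/(_ _ sD) ->.
rewrite ltNge; apply/negP => ks; move: Dir; apply/negP; rewrite -ltNge.
(* The largest distance strictly below D i: if at least k points are closer than point [i], the ball
   of radius [t] holds them and the k-NN radius is below D i. The default 0 of the maximum is
   harmless, since [Di0] puts it below D i too. *)
pose t := \big[Num.max/0]_(j < n | D j < D i) D j.
have Di0 : 0 < D i.
  rewrite lt_neqAle eucl_dist_ge0 andbT; apply/eqP => D0.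
  move: ks; rewrite big1; last first.
    by move=> j _; rewrite -/(D i) -D0 ltNge eucl_dist_ge0.
  by rewrite leNgt ltr0n; case/andP: kn => ->.
have tD : t < D i by apply: bigmax_lt.
apply: le_lt_trans tD; apply: ge_knn_radius.
  by apply: bigmax_ge_id.
apply: (le_trans ks); apply: ler_sum => j _; rewrite indicE cballE ler_nat.
have [ji|//] := ltP (eucl_dist (xs j) x).
by rewrite (@le_bigmax_cond _ _ _ 0 j (fun j => D j < D i) D)//.
Qed.

End knn.

Section knn_measurability.
Context {R : realType} {d n : nat} (k : nat) {dT : measure_display}
  {T : measurableType dT}.
Variables (xs : 'I_n -> T -> Rd R d) (ys : 'I_n -> T -> R) (x : T -> Rd R d).
Hypothesis kn : (0 < k <= n)%N.
Hypothesis mxs : forall i, measurable_fun setT (xs i).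
Hypothesis mys : forall i, measurable_fun setT (ys i).
Hypothesis mx : measurable_fun setT x.

Let measurable_boolR (b : T -> bool) : measurable_fun setT b ->
  measurable_fun setT (fun t => (b t)%:R : R).
Proof.
move=> mb.
rewrite (_ : (fun t => _) = fun t => if b t then 1 else 0); last first.
  by apply/funext => t; case: (b t).
exact: measurable_fun_ifT.
Qed.

(** Sample and query point are functions on an arbitrary measurable space, so that one statement
    covers a fixed point, a fixed sample, and both varying jointly on the product. *)
Lemma measurable_eta_hat :
  measurable_fun setT (fun t => eta_hat k (xs^~ t) (ys^~ t) (x t)).
Proof.
rewrite (_ : (fun t => _) = fun t => k%:R^-1 * \sum_(i < n)
  ((\sum_(j < n) (eucl_dist (xs j t) (x t) < eucl_dist (xs i t) (x t))%R%:R < k%:R :> R)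
   && (ys i t == 1))%:R); last first.
  apply/funext => t; rewrite /eta_hat; congr (_ * _).
  rewrite big_mkcond; apply: eq_bigr => i _; rewrite in_knn_ball//.
  by case: ifP.
apply: measurable_funM => //; apply: measurable_sum => i; apply: measurable_boolR.
apply: measurable_and; last exact: measurable_fun_eqr.
apply: measurable_fun_ltr => //; apply: measurable_sum => j; apply: measurable_boolR.
by apply: measurable_fun_ltr; exact: measurable_eucl_dist.
Qed.

Lemma measurable_eta_hat_error (h : T -> R) (a : R) : measurable_fun setT h ->
  measurable [set t | a < `|eta_hat k (xs^~ t) (ys^~ t) (x t) - h t|].
Proof.
move=> mh; rewrite (_ : [set t | _] =
    ~` [set t | `|eta_hat k (xs^~ t) (ys^~ t) (x t) - h t| <= a]).
  apply: measurableC; rewrite -[X in measurable X]setTI.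
  apply: (measurable_fun_le (g := cst a)) => //.
  by apply: measurableT_comp => //; apply: measurable_funB => //; exact: measurable_eta_hat.
by apply/seteqP; split => t /=; [rewrite ltNge => /negP|move=> /negP; rewrite -ltNge].
Qed.

End knn_measurability.

(** Fits the exponent rate e^2 / (1024 M^2) to both kinds of count, with a = k for sample points and
    b = k p for positive labels. For the points, (e / (16 M))^2 * 2 / 8 is exactly this rate; the
    labels leave room, since M + 1 <= 2 M^2. *)
Lemma deviation_exponents (R : realFieldType) (e M a b : R) :
  0 < e -> 1 <= M -> 0 < b <= a ->
  e ^+ 2 / (1024 * M ^+ 2) * b <= (e / (8 * M) / 2) ^+ 2 * (2 * a) / 8 /\
  e ^+ 2 / (1024 * M ^+ 2) * b <= (e / (2 * (M + 1))) ^+ 2 * ((M + 1) * b) / 8.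
Proof.
move=> e0 M1 /andP[b0 ba].
have M0 : 0 < M by lra.
have M2 : 0 < M ^+ 2 by rewrite exprn_gt0.
have e2 : 0 < e ^+ 2 / M ^+ 2 by rewrite divr_gt0// exprn_gt0.
have eb : e ^+ 2 / M ^+ 2 * b <= e ^+ 2 / M ^+ 2 * a by rewrite ler_pM2l.
have e2b : 0 < e ^+ 2 / M ^+ 2 * b by rewrite mulr_gt0.
have -> : e ^+ 2 / (1024 * M ^+ 2) * b = e ^+ 2 / M ^+ 2 * b / 1024.
  by field; rewrite gt_eqF.
split.
  have -> : (e / (8 * M) / 2) ^+ 2 * (2 * a) / 8 = e ^+ 2 / M ^+ 2 * a / 1024.
    by field; rewrite gt_eqF.
  lra.
have M10 : 0 < M + 1 by lra.
have -> : (e / (2 * (M + 1))) ^+ 2 * ((M + 1) * b) / 8 = e ^+ 2 * b / (M + 1) / 32.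
  by field; rewrite gt_eqF.
have h : M + 1 <= 2 * M ^+ 2.
  have : M * 1 <= M * M by rewrite ler_pM2l.
  rewrite expr2; lra.
have : e ^+ 2 / M ^+ 2 * b / 2 <= e ^+ 2 * b / (M + 1).
  have -> : e ^+ 2 / M ^+ 2 * b / 2 = e ^+ 2 * b / (2 * M ^+ 2).
    by field; rewrite gt_eqF.
  have eb0 : 0 < e ^+ 2 * b by rewrite mulr_gt0// exprn_gt0.
  by rewrite ler_pM2l// lef_pV2 ?posrE// mulr_gt0.
lra.
Qed.

(** * Deviation of the label frequency and of the k-NN estimate at a fixed point *)

Section knn_deviation.
Context {R : realType} {d n : nat} {dO dO' : measure_display}
  {Omega : measurableType dO} {Omega' : measurableType dO'}
  (P : probability Omega R) (Q : probability Omega' R).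
Variables (X : {RV Q >-> Rd R d}) (Y : {RV Q >-> R}).
Variables (Xs : 'I_n -> {RV P >-> Rd R d}) (Ys : 'I_n -> {RV P >-> R}).
Local Notation mu := (distribution Q X).
Local Notation S := (law_support X).
Local Notation Z := (fun (i : 'I_n) w => (Xs i w, Ys i w)).
Local Notation Z0 := (fun w => (X w, Y w)).
Hypothesis iidZ : iid_copies P Q Z Z0.

Let mZ i : measurable_fun setT (Z i).
Proof. by apply: measurable_fun_pair; exact: measurable_funPT. Qed.

Let mZ0 : measurable_fun setT Z0.
Proof. by apply: measurable_fun_pair; exact: measurable_funPT. Qed.

Definition deviation (A : set (Rd R d * R)) (delta m : R) : set Omega :=
  [set w | delta * m <= `| #|hits Z A w|%:R - n%:R * fine (Q (Z0 @^-1` A)) |].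

Lemma measurable_deviation A delta m : measurable A ->
  measurable (deviation A delta m).
Proof.
move=> mA; apply: (measurable_hits mZ mA (fun J =>
  delta * m <= `| #|J|%:R - n%:R * fine (Q (Z0 @^-1` A)) |)).
Qed.

Lemma probability_deviation A delta m s : measurable A -> 0 <= delta <= 2 ->
  n%:R * fine (Q (Z0 @^-1` A)) <= m -> s <= delta ^+ 2 * m / 8 ->
  (P (deviation A delta m) <= (2 * expR (- s))%:E)%E.
Proof.
move=> mA d02 nqm sdm.
have := @hits_deviation _ _ _ _ _ _ _ P Q _ Z Z0 mZ mZ0 iidZ A mA delta m d02.
rewrite card_ord => /(_ nqm) /le_trans; apply.
by rewrite lee_fin ler_wpM2l// ler_expR lerN2.
Qed.

Lemma card_hits_ball x tau w :
  #|hits Z (cball x tau `*` setT) w|%:R = ball_count (fun i => Xs i w) x tau.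
Proof.
rewrite -sum1_card natr_sum big_mkcond/=; apply: eq_bigr => i _.
rewrite inE indicE; case: (boolP (_ \in _)) => h; case: (boolP (_ \in _)) => h' //.
  by exfalso; move: h h'; rewrite inE /= => -[h _] /negP; apply; rewrite inE.
by exfalso; move: h' h; rewrite inE /= => h' /negP; apply; rewrite inE.
Qed.

Lemma card_hits_ball1 x tau w : #|hits Z (cball x tau `*` [set 1]) w|%:R =
  ball_count1 (fun i => Xs i w) (fun i => Ys i w) x tau.
Proof.
rewrite -sum1_card natr_sum big_mkcond/= [RHS]big_mkcond/=; apply: eq_bigr => i _.
rewrite inE cballE.
have -> : ((Xs i w, Ys i w) \in cball x tau `*` [set 1]) =
    (eucl_dist (Xs i w) x <= tau) && (Ys i w == 1).
  apply/idP/idP; first by rewrite inE /= => -[h /= /eqP ->]; rewrite h.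
  by move=> /andP[h /eqP h1]; rewrite inE.
by case: (_ <= _) => //=; case: (_ == _).
Qed.

Lemma card_hits_label w : n%:R^-1 * #|hits Z (setT `*` [set 1]) w|%:R =
  p_hat (fun i => Ys i w).
Proof.
congr (_ * _); rewrite -sum1_card natr_sum big_mkcond/=; apply: eq_bigr => i _.
rewrite inE.
have -> : ((Xs i w, Ys i w) \in setT `*` [set 1]) = (Ys i w == 1).
  by apply/idP/idP; [rewrite inE /= => -[_ /eqP]|move=> /eqP h1; rewrite inE].
by case: (_ == _).
Qed.

Variable (eta : Rd R d -> R).
Hypothesis heta : is_regression_function X Y eta.
Let p := fine (Q (Y @^-1` [set 1])).
Hypothesis p01 : 0 < p < 1.

Lemma p_hat_deviation (e s : R) : 0 < e <= 1 -> s <= e ^+ 2 * (n%:R * p) / 8 ->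
  exists D : set Omega, [/\ measurable D, (P D <= (2 * expR (- s))%:E)%E &
   forall w, ~ D w -> `|p_hat (fun i => Ys i w) - p| <= e * p].
Proof.
move=> /andP[e0 e1] hs.
have mA : measurable ([set: Rd R d] `*` [set (1 : R)]) by exact: measurableX.
have qE : fine (Q (Z0 @^-1` ([set: Rd R d] `*` [set (1 : R)]))) = p.
  by congr (fine (Q _)); apply/seteqP; split => w; rewrite /preimage/= => -[].
exists (deviation ([set: Rd R d] `*` [set (1 : R)]) e (n%:R * p)); split.
- exact: measurable_deviation.
- by apply: probability_deviation => //; rewrite ?qE// ltW//=; lra.
- have /andP[p0 p1] := p01.
  move=> w; rewrite /deviation/= qE => /negP; rewrite -ltNge => h.
  rewrite -card_hits_label.
  (* For n = 0 the deviation event reads 0 <= |b| and always holds, so being outside it forces n >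
     0. *)
  have n0 : 0 < n%:R :> R.
    rewrite ltr0n; case: (posnP n) => // n0; exfalso; move: h.
    have -> : n%:R = 0 :> R by rewrite n0.
    by rewrite !mul0r mulr0 ltNge normr_ge0.
  rewrite -(ler_pM2l n0) -[X in X * `|_|](gtr0_norm n0) -normrM mulrBr.
  by rewrite mulrA divff ?gt_eqF// mul1r ltW// mulrCA.
Qed.

Variables (k : nat) (f : Rd R d -> R).
Hypothesis kn : (0 < k <= n)%N.
Hypothesis hf : has_density X f.
Hypothesis d_gt0 : (0 < d)%N.

(* Distance ties and the random radius are avoided by squeezing the k-NN ball
   between two deterministic balls of mass [(1 - delta) k / n] and
   [(1 + delta) k / n]. *)
Lemma eta_hat_deviation (x : Rd R d) (L M r e : R) :
  0 < e <= 1 -> 1 <= M -> 0 <= L -> L * r <= e / 8 -> S x -> `|eta x| <= M * p ->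
  (forall y, S y -> `|eta y - eta x| <= L * p * eucl_dist y x) ->
  2 * k%:R / n%:R < mass X (cball x r) ->
  (P [set w | (e * p < `|eta_hat k (fun i => Xs i w) (fun i => Ys i w) x - eta x|)%R]
   <= (8 * expR (- (e ^+ 2 / (1024 * M ^+ 2) * (k%:R * p))))%:E)%E.
Proof.
move=> /andP[e0 e1] M1 L0 Lr Sx etax lip knr.
have /andP[p0 p1] := p01.
have [k0 kn'] := andP kn.
have k0' : 0 < k%:R :> R by rewrite ltr0n.
have n0 : 0 < n%:R :> R by rewrite ltr0n; exact: leq_trans kn'.
set s := _ * (k%:R * p).
(* Changing the mass of the ball by a fraction delta moves the expected number of positive labels by
   about delta |eta x| k <= (e / 8) p k. The variation of [eta] inside the ball costs another e / 8;
   with the cross term both fit in e / 2, and the other e / 2 is left for the fluctuation of the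
   label counts. *)
pose delta := e / (8 * M).
have d0 : 0 < delta by rewrite divr_gt0//; lra.
have dM : delta * M = e / 8 by rewrite /delta; field; rewrite gt_eqF//; lra.
have d8 : delta <= 8^-1.
  by rewrite (@le_trans _ _ (delta * M)) ?ler_peMr//; lra.
have kn0 : 0 < k%:R / n%:R :> R by rewrite divr_gt0.
have mB := measurable_cball x.
have r1 := mass_le1 X (mB r).
(* As the ball of radius [r] has mass above 2 k / n, the radius found is at most [r], where the
   Lipschitz bound costs no more than (e / 8) p. A negative radius is excluded because its ball
   would be empty. *)
have ex u : 0 < u <= 2 -> exists tau, [/\ 0 <= tau, tau <= r &
    n%:R * mass X (cball x tau) = u * k%:R].
  move=> /andP[u0 u2].
  have u1 : u * (k%:R / n%:R) <= 2 * k%:R / n%:R by rewrite -mulrA ler_pM2r.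
  have [||tau htau] := @law_cball_surjective _ _ _ _ _ X f hf x (u * (k%:R / n%:R)) => //.
    by rewrite mulr_gt0//= (le_lt_trans u1)// (lt_le_trans knr).
  have htau' : mass X (cball x tau) = u * (k%:R / n%:R) by rewrite /mass htau.
  exists tau; split.
  - rewrite leNgt; apply/negP => tau0.
    have : (0 : \bar R) = (u * (k%:R / n%:R))%:E.
      rewrite -htau; apply/esym; rewrite [cball _ _](_ : _ = set0) ?measure0//.
      apply/seteqP; split => // y /=; rewrite /cball/= => h.
      by have := eucl_dist_ge0 y x; rewrite leNgt (le_lt_trans h).
    by move=> [] /esym; apply/eqP; rewrite gt_eqF// mulr_gt0.
  - rewrite leNgt; apply/negP => /ltW rtau.
    have : mass X (cball x r) <= mass X (cball x tau).
      by apply: le_mass => // y /= /le_trans; apply.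
    by rewrite htau'; lra.
  - by rewrite htau'; field; rewrite gt_eqF.
have [|tm [tm0 tmr htm]] := ex (1 - delta); first lra.
have [|tp [tp0 tpr htp]] := ex (1 + delta); first lra.
have lipr t : t <= r -> forall y, S y -> cball x t y -> `|eta y - eta x| <= L * p * r.
  move=> tr y Sy By; apply: (le_trans (lip y Sy)).
  by rewrite ler_wpM2l ?(le_trans By)// mulr_ge0// ltW.
have bnd t : 0 <= t -> t <= r ->
    (eta x - e / 8 * p) * (n%:R * mass X (cball x t)) <= n%:R * mass1 X Y (cball x t)
    <= (eta x + e / 8 * p) * (n%:R * mass X (cball x t)).
  move=> t0 tr.
  have /andP[lo hi] := regression_ball_bounds heta (lipr t tr).
  have Lpr : L * p * r <= e / 8 * p by rewrite mulrAC ler_pM2r.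
  have nm := mass_ge0 X (cball x t).
  rewrite !(mulrCA _ n%:R) !ler_pM2l//; apply/andP; split.
    by apply: le_trans lo; rewrite ler_wpM2r//; lra.
  by apply: (le_trans hi); rewrite ler_wpM2r//; lra.
have /andP[lom him] := bnd tm tm0 tmr.
have /andP[lop hip] := bnd tp tp0 tpr.
rewrite htm in lom him; rewrite htp in lop hip.
have mC t : measurable (cball x t `*` [set: R]) by exact: measurableX.
have mC1 t : measurable (cball x t `*` [set (1 : R)]) by exact: measurableX.
have qC t : fine (Q (Z0 @^-1` (cball x t `*` [set: R]))) = mass X (cball x t).
  by congr (fine (Q _)); apply/seteqP; split => w; rewrite /preimage/=; [case|].
have qC1 t : fine (Q (Z0 @^-1` (cball x t `*` [set (1 : R)]))) = mass1 X Y (cball x t).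
  by [].
(* The expected number of positive labels in either ball is at most [m1], and delta1 * m1 = (e / 2)
   k p is the fluctuation still affordable. *)
pose delta1 := e / (2 * (M + 1)).
pose m1 := (M + 1) * (k%:R * p).
have kp0 : 0 < k%:R * p by rewrite mulr_gt0.
have d1m1 : delta1 * m1 = e / 2 * (k%:R * p).
  by rewrite /delta1 /m1; field; rewrite gt_eqF//; lra.
(* Here (delta / 2) * (2 k) = delta k is exactly the gap between k and the expected counts (1 -
   delta) k and (1 + delta) k, while 2 k bounds both of these. *)
pose D1 := deviation (cball x tm `*` [set: R]) (delta / 2) (2 * k%:R).
pose D2 := deviation (cball x tp `*` [set: R]) (delta / 2) (2 * k%:R).
pose D3 := deviation (cball x tm `*` [set (1 : R)]) delta1 m1.
pose D4 := deviation (cball x tp `*` [set (1 : R)]) delta1 m1.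
have ep0 : 0 <= e * p by apply: mulr_ge0; exact: ltW.
have de : `|delta * eta x| <= e / 8 * p.
  by rewrite normrM (gtr0_norm d0) -dM -mulrA ler_pM2l.
have hlo : (eta x - e / 2 * p) * k%:R <= (eta x - e / 8 * p) * ((1 - delta) * k%:R).
  rewrite mulrA ler_pM2r//; move: de; rewrite ler_norml => /andP[_ de].
  have : 0 <= delta * (e * p).
    by apply: mulr_ge0 => //; exact: ltW.
  lra.
have hhi : (eta x + e / 8 * p) * ((1 + delta) * k%:R) <= (eta x + e / 2 * p) * k%:R.
  rewrite mulrA ler_pM2r//; move: de; rewrite ler_norml => /andP[de1 de].
  have : delta * (e * p) <= 8^-1 * (e * p) by rewrite ler_wpM2r.
  lra.
have mass1m : n%:R * mass1 X Y (cball x tp) <= m1.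
  apply: (le_trans hip); apply: (le_trans hhi); rewrite /m1 [k%:R * p]mulrC mulrA.
  rewrite ler_pM2r//; move: etax; rewrite ler_norml => /andP[_].
  have : e / 2 * p <= 1 * p by rewrite ler_pM2r//; lra.
  lra.
have mass1m' : n%:R * mass1 X Y (cball x tm) <= m1.
  apply: le_trans mass1m; rewrite ler_pM2l//.
  have tmtp : tm <= tp.
    rewrite leNgt; apply/negP => /ltW h.
    have : mass X (cball x tp) <= mass X (cball x tm).
      by apply: le_mass => // y /= /le_trans; apply.
    rewrite -(ler_pM2l n0) htm htp ler_pM2r//; lra.
  rewrite -lee_fin !mass1E//; apply: le_measure; rewrite ?inE.
  - by rewrite -[X in measurable X]setTI; apply: (mZ0 _ (mC1 tm)).
  - by rewrite -[X in measurable X]setTI; apply: (mZ0 _ (mC1 tp)).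
  - by apply: setSI => w; rewrite /preimage /= => /le_trans; apply.
have sub : [set w | (e * p < `|eta_hat k (fun i => Xs i w) (fun i => Ys i w) x - eta x|)%R]
    `<=` ((D1 `|` D2) `|` (D3 `|` D4)).
  move=> w /= bad; apply: contrapT => /not_orP[/not_orP[n1 n2] /not_orP[n3 n4]].
  move: n1 n2 n3 n4; rewrite /D1 /D2 /D3 /D4 /deviation/= !qC !qC1.
  rewrite !card_hits_ball !card_hits_ball1 htm htp d1m1.
  have nle (a b : R) : ~ (a <= `|b|) -> - a < b /\ b < a.
    by move=> /negP; rewrite -ltNge ltr_norml => /andP.
  move=> /nle[_ N1] /nle[N2 _] /nle[V1 _] /nle[_ V2].
  have hs : ball_count (fun i => Xs i w) x tm < k%:R by lra.
  have ht : k%:R <= ball_count (fun i => Xs i w) x tp by lra.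
  have /andP[v1 v2] := eta_hat_sandwich (fun i => Ys i w) kn hs tp0 ht.
  move: bad; rewrite ltNge => /negP bad; apply: bad.
  rewrite -(ler_pM2l k0') -[X in X * `|_|](gtr0_norm k0') -normrM mulrBr ler_norml.
  by apply/andP; split; lra.
have kp1 : k%:R * p <= k%:R by rewrite ler_piMr ?ltW.
have [s1 s3] : s <= (delta / 2) ^+ 2 * (2 * k%:R) / 8 /\ s <= delta1 ^+ 2 * m1 / 8.
  by apply: deviation_exponents => //; rewrite kp0.
have d2 : 0 <= delta / 2 <= 2 by apply/andP; split; lra.
have d12 : 0 <= delta1 <= 2.
  have M4 : 0 < 2 * (M + 1) by lra.
  rewrite /delta1; apply/andP; split; first by apply: divr_ge0; exact: ltW.
  by rewrite ler_pdivrMr//; lra.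
have P1 : (P D1 <= (2 * expR (- s))%:E)%E.
  apply: probability_deviation => //; rewrite qC htm ler_pM2r//; lra.
have P2 : (P D2 <= (2 * expR (- s))%:E)%E.
  apply: probability_deviation => //; rewrite qC htp ler_pM2r//; lra.
have P3 : (P D3 <= (2 * expR (- s))%:E)%E by apply: probability_deviation.
have P4 : (P D4 <= (2 * expR (- s))%:E)%E by apply: probability_deviation.
have mD1 : measurable D1 by exact: measurable_deviation.
have mD2 : measurable D2 by exact: measurable_deviation.
have mD3 : measurable D3 by exact: measurable_deviation.
have mD4 : measurable D4 by exact: measurable_deviation.
have mbad : measurable
    [set w | (e * p < `|eta_hat k (fun i => Xs i w) (fun i => Ys i w) x - eta x|)%R].
  apply: (@measurable_eta_hat_error _ _ _ k _ _ (fun i w => Xs i w)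
    (fun i w => Ys i w) (cst x) kn _ _ _ (cst (eta x)) (e * p)) => // i;
  exact: measurable_funPT.
apply: (@le_trans _ _ (P ((D1 `|` D2) `|` (D3 `|` D4)))).
  by apply: le_measure; rewrite ?inE//; do ?apply: measurableU.
apply: (le_trans (measureU2 _ _ _)); [exact: measurableU|exact: measurableU|].
apply: (le_trans (leeD (measureU2 _ mD1 mD2) (measureU2 _ mD3 mD4))).
apply: (le_trans (leeD (leeD P1 P2) (leeD P3 P4))).
rewrite -!EFinD lee_fin; lra.
Qed.

End knn_deviation.

(** * Almost sure convergence *)

(** Passes from the failure probability at each fixed point to the random mass of the failing
    points, whose mean is computed in the other order of integration. *)
Lemma fubini_markov {R : realType} {d1 d2 : measure_display}
    {T1 : measurableType d1} {T2 : measurableType d2}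
    (m1 : probability T1 R) (m2 : probability T2 R) (B : set (T1 * T2)) (a b : R) :
  measurable B -> 0 < a -> (forall x, (m2 (xsection B x) <= b%:E)%E) ->
  measurable [set y | (a%:E <= m1 (ysection B y))%E] /\
  (m2 [set y | (a%:E <= m1 (ysection B y))%E] <= (b / a)%:E)%E.
Proof.
move=> mB a0 hb.
have mphi : measurable_fun setT (m1 \o ysection B) by exact: measurable_fun_ysection.
split.
  rewrite (_ : [set y | _] = (m1 \o ysection B) @^-1` `[a%:E, +oo[%classic).
    by rewrite -[_ @^-1` _]setTI; apply: mphi => //; exact: emeasurable_itv.
  apply/seteqP; split => y; rewrite /preimage/= in_itv/= ?andbT//.
have swap : (\int[m2]_y m1 (ysection B y) = \int[m1]_x m2 (xsection B x))%E.
  apply/esym; apply: (@product_measure_unique _ _ _ _ _ m1 m2 (product_measure2 m1 m2) _ B mB).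
  by move=> A1 A2 mA1 mA2; exact: product_measure2E.
have hint : (\int[m2]_y m1 (ysection B y) <= b%:E)%E.
  rewrite swap; apply: (@le_trans _ _ (\int[m1]_x b%:E)%E).
    apply: ge0_le_integral => //; exact: measurable_fun_xsection.
  rewrite integral_cst//= -[leRHS]mule1; apply: lee_wpmul2l.
    by rewrite (le_trans _ (hb point)).
  exact: probability_le1.
have mk := @le_integral_comp_abse _ _ _ m2 _ measurableT (m1 \o ysection B) a id
  (@measurable_id _ _ _) (fun _ h => h) _ mphi a0.
rewrite setTI in mk.
have {}mk : (a%:E * m2 [set y | a%:E <= m1 (ysection B y)] <= b%:E)%E.
  apply: le_trans hint; apply: (le_trans _ (le_trans (mk _) _)).
  - apply: lee_wpmul2l; first by rewrite lee_fin ltW.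
    rewrite (_ : [set y | _] = [set x | a%:E <= `|(m1 \o ysection B) x|]%E)//.
    by apply/seteqP; split => y /=; rewrite gee0_abs.
  - by [].
  - by rewrite (eq_integral (m1 \o ysection B))// => y _ /=; rewrite gee0_abs.
by rewrite EFinM muleC lee_pdivlMl.
Qed.

(** The majorant telescopes, so its partial sums are at most C. Failures of [G n] are merely covered
    by events, which leaves [G n] itself free of measurability, and the shift by [N] accommodates
    bounds that hold only eventually. *)
Lemma borel_cantelli_ae {R : realType} {d : measure_display} {T : measurableType d}
    (P : probability T R) (G : nat -> T -> Prop) (C : R) (N : nat) :
  (forall n, (N <= n)%N -> exists A, [/\ measurable A,
     (P A <= (C * (n.+1%:R^-1 - n.+2%:R^-1))%:E)%E & forall w, ~ A w -> G n w]) ->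
  {ae P, forall w, exists N', forall n, (N' <= n)%N -> G n w}.
Proof.
move=> hA.
have /choice[A HA] : forall n, exists A, [/\ measurable A,
    (P A <= (C * ((n + N).+1%:R^-1 - (n + N).+2%:R^-1))%:E)%E &
    forall w, ~ A w -> G (n + N)%N w].
  by move=> n; apply: hA; rewrite leq_addl.
have step_gt0 n : 0 < n.+1%:R^-1 - n.+2%:R^-1 :> R.
  by rewrite subr_gt0 ltf_pV2 ?posrE// ltr_nat.
have C0 : 0 <= C.
  have [_ h _] := HA 0%N; have := le_trans (measure_ge0 P (A 0%N)) h.
  by rewrite lee_fin pmulr_lge0.
have lim0 : P (lim_sup_set A) = 0%E.
  apply: lim_sup_set_cvg0; first by move=> n; have [] := HA n.
  apply: (@le_lt_trans _ _ C%:E); last exact: ltry.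
  apply: lime_le; first by apply: is_cvg_nneseries.
  apply: nearW => n; apply: (@le_trans _ _ (\sum_(0 <= i < n)
      (C * ((i + N).+1%:R^-1 - (i + N).+2%:R^-1))%:E)%E).
    by apply: lee_sum => i _; have [] := HA i.
  rewrite sumEFin lee_fin -mulr_sumr ler_piMr//.
  have -> : \sum_(0 <= i < n) ((i + N).+1%:R^-1 - (i + N).+2%:R^-1) =
      N.+1%:R^-1 - (n + N).+1%:R^-1 :> R.
    transitivity (\sum_(0 <= i < n) (- (i.+1 + N).+1%:R^-1 - - (i + N).+1%:R^-1) : R).
      by apply: eq_bigr => i _; rewrite opprK addrC addSn.
    by rewrite (telescope_sumr (fun i => - (i + N).+1%:R^-1 : R))// opprK addrC.
  have h1 : N.+1%:R^-1 <= 1 :> R by rewrite invf_le1// ler1n.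
  by rewrite lerBlDr (le_trans h1)// lerDl invr_ge0.
exists (lim_sup_set A); split => //.
  rewrite /lim_sup_set; apply: bigcap_measurable => // k _.
  by apply: bigcup_measurable => n _; have [] := HA n.
move=> w /= h k _; apply: contrapT => nh; apply: h.
exists (k + N)%N => n kn.
have Nn : (N <= n)%N by rewrite (leq_trans _ kn)// leq_addl.
have [_ _] := HA (n - N)%N; rewrite subnK//; apply => Aw; apply: nh.
by exists (n - N)%N => //=; rewrite leq_subRL// addnC.
Qed.

(** In the failure probability, 2 comes from [p_hat] and 8 / e from the Markov bound at level e for
    the mass of the points where [eta_hat] errs. Otherwise a disagreement with the Bayes rule off
    these points forces |eta - p| <= 2 e p, and they have mass at most e: hence 2 e + (M + 1) e = (M
    + 3) e. *)
Lemma knn_excess_event {R : realType} {d n k : nat} {dO dO' : measure_display}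
    {Omega : measurableType dO} {Omega' : measurableType dO'}
    (P : probability Omega R) (Q : probability Omega' R)
    (X : {RV Q >-> Rd R d}) (Y : {RV Q >-> R})
    (Xs : 'I_n -> {RV P >-> Rd R d}) (Ys : 'I_n -> {RV P >-> R})
    (eta f : Rd R d -> R) (L M r e p : R) :
  iid_copies P Q (fun (i : 'I_n) w => (Xs i w, Ys i w)) (fun w => (X w, Y w)) ->
  is_regression_function X Y eta -> has_density X f -> (0 < d)%N ->
  (forall w, Y w = 1 \/ Y w = -1) -> (0 < k <= n)%N ->
  p = fine (Q (Y @^-1` [set 1])) -> 0 < p < 1 ->
  0 < e <= 1 -> 1 <= M -> 0 <= L -> L * r <= e / 8 ->
  (forall x, law_support X x -> `|eta x| <= M * p) ->
  (forall x y, law_support X x -> law_support X y ->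
    `|eta y - eta x| <= L * p * eucl_dist y x) ->
  (forall x, law_support X x -> 2 * k%:R / n%:R < mass X (cball x r)) ->
  exists A : set Omega, [/\ measurable A,
    (P A <= ((2 + 8 / e) * expR (- (e ^+ 2 / (1024 * M ^+ 2) * (k%:R * p))))%:E)%E &
    forall w, ~ A w ->
      0 <= balanced_risk X Y (balanced_knn k (fun i => Xs i w) (fun i => Ys i w))
           - balanced_risk X Y (balanced_bayes p eta)
        <= (M + 3) * e / (1 - p)].
Proof.
move=> iidZ heta hf d0 Y2 kn pE p01 e01 M1 L0 Lr etaM lip knr.
have /andP[e0 e1] := e01; have /andP[p0 p1] := p01; have /andP[k0 kn'] := kn.
set s := _ * (k%:R * p).
have p01' : 0 < fine (Q (Y @^-1` [set 1])) < 1 by rewrite -pE.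
have M2 : 1 <= M ^+ 2 by rewrite exprn_ege1.
have kp0 : 0 <= k%:R * p by apply: mulr_ge0 => //; exact: ltW.
have knp : k%:R * p <= n%:R * p by rewrite ler_pM2r// ler_nat.
(* The label frequency uses all n >= k points, so its exponent dominates that of the neighbours. *)
have ss : s <= e ^+ 2 * (n%:R * fine (Q (Y @^-1` [set 1]))) / 8.
  rewrite -pE /s.
  have -> : e ^+ 2 / (1024 * M ^+ 2) * (k%:R * p) =
      (e ^+ 2 * (k%:R * p)) / M ^+ 2 / 1024.
    by field; rewrite gt_eqF//; lra.
  have e2 : 0 <= e ^+ 2 := sqr_ge0 e.
  have h1 : e ^+ 2 * (k%:R * p) <= e ^+ 2 * (n%:R * p) by rewrite ler_wpM2l.
  have h0 : 0 <= e ^+ 2 * (k%:R * p) by exact: mulr_ge0.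
  have : (e ^+ 2 * (k%:R * p)) / M ^+ 2 <= e ^+ 2 * (k%:R * p).
    by rewrite ler_piMr// invf_le1//; lra.
  lra.
have [D [mD PD hD]] := p_hat_deviation iidZ p01' e01 ss.
rewrite -pE in hD.
(* The failure set in point and sample jointly, cut down to the support because the pointwise
   deviation bound is available there only; [balanced_excess_bound] likewise looks only at points of
   the support. *)
pose B : set (Rd R d * Omega) := (law_support X `*` setT) `&`
  [set z | e * p < `|eta_hat k (fun i => Xs i z.2) (fun i => Ys i z.2) z.1 - eta z.1|].
have [meta _] := heta.
have mB : measurable B.
  apply: measurableI; first by apply: measurableX => //; exact: measurable_law_support.
  apply: (@measurable_eta_hat_error _ _ _ k _ _ (fun i (z : Rd R d * Omega) => Xs i z.2)
    (fun i (z : Rd R d * Omega) => Ys i z.2) fst kn _ _ _ (eta \o fst) (e * p)) => //.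
  - by move=> i; apply: measurableT_comp => //; exact: measurable_funPT.
  - by move=> i; apply: measurableT_comp => //; exact: measurable_funPT.
  - exact: measurableT_comp.
have [|mE PE] := @fubini_markov R _ _ _ _ (distribution Q X) P B e (8 * expR (- s)) mB e0.
  move=> x; have [Sx|nSx] := pselect (law_support X x); last first.
    rewrite [xsection B x](_ : _ = set0) ?measure0 ?lee_fin ?mulr_ge0 ?expR_ge0//.
    by apply/seteqP; split => // w; rewrite /xsection/= inE => -[[]].
  have etax := etaM x Sx; rewrite pE in etax.
  have lipx y : law_support X y ->
      `|eta y - eta x| <= L * fine (Q (Y @^-1` [set 1])) * eucl_dist y x.
    by move=> Sy; rewrite -pE; exact: lip.
  have := eta_hat_deviation iidZ heta p01' kn hf d0 e01 M1 L0 Lr Sx etax lipx (knr x Sx).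
  rewrite -pE; congr (P _ <= _)%E; apply/seteqP; split => w; rewrite /xsection/= inE.
    by move=> ?; split.
  by case.
exists (D `|` [set w | (e%:E <= distribution Q X (ysection B w))%E]); split.
- exact: measurableU.
- apply: (le_trans (measureU2 _ mD mE)); apply: (le_trans (leeD PD PE)).
  by rewrite -EFinD lee_fin [X in _ <= X]mulrDl lerD2l (mulrAC 8).
move=> w /not_orP[/hD pw /negP]; rewrite -ltNge => Bw.
have mBw : measurable (ysection B w) by exact: measurable_ysection.
have massBw : mass X (ysection B w) <= e by rewrite -lee_fin massE// ltW.
have mg : measurable [set x |
    balanced_knn k (fun i => Xs i w) (fun i => Ys i w) x = 1].
  rewrite (_ : [set x | _] =
      [set x | p_hat (fun i => Ys i w) <= eta_hat k (fun i => Xs i w) (fun i => Ys i w) x]).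
    rewrite -[X in measurable X]setTI.
    apply: (measurable_fun_le (f := cst (p_hat (fun i => Ys i w)))) => //.
    exact: (@measurable_eta_hat _ _ _ k _ _ (fun i (_ : Rd R d) => Xs i w)
      (fun i (_ : Rd R d) => Ys i w) id kn).
  have n11 : (-1 : R) <> 1 by apply/eqP; rewrite lt_eqF//; lra.
  by apply/seteqP; split => x; rewrite /balanced_knn/=; case: ifP.
have := @balanced_excess_bound _ _ _ _ _ X Y eta heta p01' Y2
  (balanced_knn k (fun i => Xs i w) (fun i => Ys i w)) (ysection B w) M (2 * e).
rewrite -pE => /(_ mg) h.
have /andP[-> hi] : 0 <= balanced_risk X Y (balanced_knn k (Xs^~ w) (Ys^~ w))
    - balanced_risk X Y (balanced_bayes p eta)
    <= (2 * e + (M + 1) * mass X (ysection B w)) / (1 - p).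
  apply: h => //.
  - by move=> x; rewrite /balanced_knn; case: ifP; [left|right].
  - lra.
  - lra.
  - move=> x Sx Bx; rewrite /balanced_knn /balanced_bayes.
    have : `|eta_hat k (fun i => Xs i w) (fun i => Ys i w) x - eta x| <= e * p.
      rewrite leNgt; apply/negP => h'; apply: Bx.
      by rewrite /ysection/= inE; split.
    move: pw; rewrite !ler_norml => /andP[q1 q2] /andP[q3 q4].
    (* Opposite decisions mean that [eta_hat] - [p_hat] and [eta] - [p] have opposite signs, while
       they differ by at most 2 e p. *)
    case: (lerP (p_hat _)) => c1; case: (lerP p) => c2 // _;
    by apply/andP; split; lra.
rewrite /= (le_trans hi)// ler_pM2r ?invr_gt0; last lra.
have : (M + 1) * mass X (ysection B w) <= (M + 1) * e by rewrite ler_wpM2l//; lra.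
lra.
Qed.

(** exp(- s) <= n^-2, and (n + 1)(n + 2) <= 6 n^2 with equality at n = 1. *)
Lemma expR_le_telescope {R : realType} (n : nat) (s : R) : (0 < n)%N ->
  2 * ln n%:R <= s -> expR (- s) <= 6 * (n.+1%:R^-1 - n.+2%:R^-1).
Proof.
move=> n0 hs; have n0' : 1 <= n%:R :> R by rewrite ler1n.
have n1 : 0 < n%:R :> R by rewrite ltr0n.
apply: (@le_trans _ _ (n%:R ^- 2)).
  by rewrite -[X in _ <= X ^- 2]lnK ?posrE// -expRM_natl -expRN ler_expR lerN2.
have -> : n.+1%:R^-1 - n.+2%:R^-1 = ((n%:R + 1) * (n%:R + 2))^-1 :> R.
  rewrite -(natr1 n.+1) -(natr1 n); field.
  by rewrite !gt_eqF//; lra.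
rewrite -[leLHS]mul1r ler_pdivrMr ?exprn_gt0// mulrAC.
rewrite ler_pdivlMr ?mul1r; last by rewrite mulr_gt0//; lra.
by rewrite expr2; nra.
Qed.

Theorem corollary3p5 (R : realType) (d : nat) (d_gt0 : (0 < d)%N)
  (dO' : measure_display) (Omega' : measurableType dO')
  (Q : probability Omega' R)
  (X : {RV Q >-> Rd R d}) (Y : nat -> {RV Q >-> R})
  (dO : measure_display) (Omega : measurableType dO)
  (P : probability Omega R)
  (Xs : forall n : nat, 'I_n -> {RV P >-> Rd R d})
  (Ys : forall n : nat, 'I_n -> {RV P >-> R})
  (fX : Rd R d -> R) (SX : set (Rd R d)) (c T bX UX L : R)
  (p : nat -> R) (eta : nat -> Rd R d -> R) (k : nat -> nat)
  (hfX : has_density X fX)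
  (hSX : SX = law_support X)
  (SX_compact : compact_Rd SX)
  (c_gt0 : 0 < c) (T_gt0 : 0 < T)
  (X2 : forall (x : Rd R d) (tau : R), SX x -> 0 < tau <= T ->
     (c%:E * lebesgue_Rd d (cball x tau)
        <= lebesgue_Rd d (SX `&` cball x tau))%E)
  (bX_gt0 : 0 < bX) (bX_le_UX : bX <= UX)
  (X3 : forall x : Rd R d, SX x -> bX <= fX x <= UX)
  (hY : forall n : nat, (0 < n)%N -> forall w : Omega',
     Y n w = 1 \/ Y n w = -1)
  (hp : forall n : nat, p n = fine (Q (Y n @^-1` [set 1])))
  (p01 : forall n : nat, (0 < n)%N -> 0 < p n < 1)
  (hk : forall n : nat, (0 < n)%N -> (1 <= k n <= n)%N)
  (heta : forall n : nat, (0 < n)%N ->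
     is_regression_function X (Y n) (eta n))
  (eta_lip : forall n : nat, (0 < n)%N ->
     forall x y : Rd R d, SX x -> SX y ->
       `|eta n x / p n - eta n y / p n| <= L * eucl_dist x y)
  (hiid : forall n : nat,
     iid_copies P Q (fun (i : 'I_n) w => (Xs n i w, Ys n i w))
                    (fun w => (X w, Y n w)))
  (p_to0 : p n @[n --> \oo] --> (0 : R))
  (kp_log : (k n)%:R * p n / ln (n%:R : R) @[n --> \oo] --> +oo)
  (k_n : (k n)%:R / n%:R @[n --> \oo] --> (0 : R)) :
  {ae P, forall w,
     balanced_risk X (Y n)
       (balanced_knn (k n) (fun i => Xs n i w) (fun i => Ys n i w))
     - balanced_risk X (Y n) (balanced_bayes (p n) (eta n))
     @[n --> \oo] --> (0 : R)}.

Proof.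
(* [L] comes without a sign; its absolute value is a Lipschitz constant as well. *)
pose L' : R := `|L|; have L'0 : 0 <= L' by exact: normr_ge0.
have hS x : SX x = law_support X x by rewrite hSX.
have lipn n : (0 < n)%N -> forall x y, law_support X x -> law_support X y ->
    `|eta n x / p n - eta n y / p n| <= L' * eucl_dist x y.
  move=> n0 x y; rewrite -!hS => Sx Sy; have h := eta_lip n n0 x y Sx Sy.
  by apply: (le_trans h); rewrite ler_wpM2r ?eucl_dist_ge0// ler_norm.
have lip n : (0 < n)%N -> forall x y, law_support X x -> law_support X y ->
    `|eta n y - eta n x| <= L' * p n * eucl_dist y x.
  move=> n0 x y Sx Sy; have /andP[p0 _] := p01 n n0.
  have ip : 0 < (p n)^-1 by rewrite invr_gt0.
  have := lipn n n0 y x Sy Sx.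
  by rewrite -mulrBl normrM (gtr0_norm ip) ler_pdivrMr// mulrAC.
have X2' x tau : law_support X x -> 0 < tau <= T ->
    (c%:E * lebesgue_Rd d (cball x tau) <=
     lebesgue_Rd d (law_support X `&` cball x tau))%E.
  by rewrite -hSX; exact: X2.
have X3' x : law_support X x -> bX <= fX x by rewrite -hS => /X3 /andP[].
have cball_mass r : 0 < r -> exists2 m : R, 0 < m &
    forall x, law_support X x -> (m%:E <= distribution Q X (cball x r))%E.
  exact: (law_cball_ge hfX c_gt0 T_gt0 X2' bX_gt0 X3').
have [m m0 hm] := cball_mass 1 ltr01.
(* The bound on |eta| / p given by balls of radius 1, increased by 1 so that M >= 1. *)
pose M := L' * 1 + m^-1 + 1.
have M1 : 1 <= M.
  by rewrite /M lerDr addr_ge0 ?mulr1// invr_ge0 ltW.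
have etaM n : (0 < n)%N -> forall x, law_support X x -> `|eta n x| <= M * p n.
  move=> n0 x Sx; have /andP[p0 _] := p01 n n0.
  have pn01 := p01 n n0; have lipn' := lipn n n0; rewrite hp in pn01 lipn'.
  have := regression_bounded (heta n n0) pn01 ltr01 m0 L'0 lipn' hm Sx.
  move=> /le_trans; apply; rewrite -hp ler_pM2r// /M; lra.
have M3 : 0 < 2 * (M + 3) by lra.
pose excess n w := balanced_risk X (Y n)
       (balanced_knn (k n) (fun i => Xs n i w) (fun i => Ys n i w))
     - balanced_risk X (Y n) (balanced_bayes (p n) (eta n)).
(* The factor 2 bounds 1 / (1 - p), as p < 1/2 eventually. *)
have key e : 0 < e <= 1 -> {ae P, forall w, exists N', forall n, (N' <= n)%N ->
    0 <= excess n w <= 2 * (M + 3) * e}.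
  move=> e01; have /andP[e0 e1] := e01.
  (* A radius over which eta / p varies by at most e / 8; L' + 1 avoids a division by zero. *)
  pose r := e / (8 * (L' + 1)).
  have L1 : 0 < L' + 1 by lra.
  have r0 : 0 < r by rewrite divr_gt0// mulr_gt0.
  have Lr : L' * r <= e / 8.
    have -> : e / 8 = (L' + 1) * r by rewrite /r; field; rewrite gt_eqF.
    by rewrite ler_pM2r//; lra.
  have [mr mr0 hmr] := cball_mass r r0.
  pose kappa := e ^+ 2 / (1024 * M ^+ 2).
  have kappa0 : 0 < kappa.
    by apply: divr_gt0; [exact: exprn_gt0|apply: mulr_gt0; [rewrite ltr0n|apply: exprn_gt0; lra]].
  have mr2 : 0 < mr / 2 by lra.
  have half0 : (0 : R) < 2^-1 by lra.
  (* n > 1 makes ln n positive, mr / 2 puts 2 k / n below the mass of the balls of radius [r], and 2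
     / kappa gives kappa k p >= 2 ln n, hence summable probabilities. *)
  have [N _ HN] : \forall n \near \oo, [/\ (1 < n)%N, p n < 2^-1,
      (k n)%:R / n%:R < mr / 2 & 2 / kappa <= (k n)%:R * p n / ln (n%:R : R)].
    near=> n; split; near: n.
    - exact: nbhs_infty_gt.
    - exact: (cvgr_lt 0 p_to0).
    - exact: (cvgr_lt 0 k_n).
    - by move/cvgryPge : kp_log; apply.
  apply: (@borel_cantelli_ae _ _ _ P _ ((2 + 8 / e) * 6) N) => n /HN[n1 pn kn kpn].
  have n0 : (0 < n)%N by exact: ltn_trans n1.
  have pn01 := p01 n n0.
  have knn x : law_support X x -> 2 * (k n)%:R / n%:R < mass X (cball x r).
    move=> Sx; apply: (@lt_le_trans _ _ mr); first by rewrite -mulrA; lra.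
    by rewrite -lee_fin massE ?hmr//; exact: measurable_cball.
  have [A [mA PA hA]] := knn_excess_event (hiid n) (heta n n0) hfX d_gt0 (hY n n0)
    (hk n n0) (hp n) pn01 e01 M1 L'0 Lr (etaM n n0) (lip n n0) knn.
  exists A; split => //.
    apply: (le_trans PA); rewrite lee_fin -[X in _ <= X]mulrA; apply: ler_wpM2l.
      by apply: addr_ge0 => //; apply: divr_ge0 => //; exact: ltW.
    apply: expR_le_telescope => //.
    have ln0 : 0 < ln (n%:R : R) by rewrite ln_gt0// ltr1n.
    move: kpn; rewrite ler_pdivlMr// -(ler_pM2l kappa0) => h.
    by apply: le_trans h; rewrite mulrA mulrCA divff ?gt_eqF// mulr1.
  move=> w /hA /andP[ge0 le1]; rewrite ge0/=; apply: (le_trans le1).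
  have p1 : 0 < 1 - p n by lra.
  rewrite ler_pdivrMr// -!mulrA.
  have : 0 <= (M + 3) * e by apply: mulr_ge0; lra.
  have : (M + 3) * e * p n <= (M + 3) * e * 2^-1.
    by apply: ler_wpM2l; [apply: mulr_ge0; lra|exact: ltW].
  lra.
have inv01 j : 0 < (j.+1%:R^-1 : R) <= 1 by rewrite invr_gt0 ltr0n/= invf_le1// ler1n.
(* The null set of [key] depends on the accuracy, so only the countably many accuracies 1/(j+1) are
   used. *)
apply: (negligibleS _ (negligible_bigcup (fun j => key j.+1%:R^-1 (inv01 j)))).
move=> w /= nlim; apply: contrapT => hw; apply: nlim.
apply/cvgrPdist_le => e e0.
have /ltr_add_invr[j] : 0 < e / (2 * (M + 3)) by rewrite divr_gt0.
rewrite add0r ltr_pdivlMr// => /ltW je.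
have [N' HN'] : exists N', forall n, (N' <= n)%N ->
    0 <= excess n w <= 2 * (M + 3) * j.+1%:R^-1.
  by apply: contrapT => h; apply: hw; exists j.
exists N' => // n /= /HN' /andP[ge0 le1].
by rewrite sub0r normrN ger0_norm// (le_trans le1)// mulrC.
Unshelve. all: by end_near. Qed.
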